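(* Let $\alpha\in\mathbb{R}\setminus\pi\mathbb{Z}$. (a) For $f\in e_{-\alpha}L^1(\mathbf{T}^n_\alpha)$ let $$\mathcal{H}_\alpha f:=\sup_{N\in\mathbb{Z}^+}\big|f\overset{\alpha}{\ast}F^n_N\big|.$$ Then $\mathcal{H}_\alpha$ maps $e_{-\alpha}L^1(\mathbf{T}^n_\alpha)$ to $L^{1,\infty}(\mathbf{T}^n_\alpha)$ and $e_{-\alpha}L^p(\mathbf{T}^n_\alpha)$ to $L^p(\mathbf{T}^n_\alpha)$ for $1<p\le\infty$. (b) For any function $f\in e_{-\alpha}L^1(\mathbf{T}^n_\alpha)$, as $N\to\infty$, $$f\overset{\alpha}{\ast}F^n_N\to f\quad\text{a.e.}$$
   Context: Let $n\ge 1$ and $\alpha\in\mathbb{R}\setminus\pi\mathbb{Z}$. The fractional torus $\mathbf{T}^n_\alpha$ is the cube of side $|\sin\alpha|$ with opposite sides identified, represented by $[-|\sin\alpha|/2,|\sin\alpha|/2]^n$; functions on $\mathbf{T}^n_\alpha$ are functions on $\mathbb{R}^n$ that are $|\sin\alpha|$-periodic in each coordinate, equivalently functions on this cube, and integrals and norms over $\mathbf{T}^n_\alpha$ are taken over this cube with Lebesgue measure. $L^{1,\infty}$ is weak $L^1$. Put $e_\alpha(x)=e^{\pi i|x|^2\cot\alpha}$, $e_{-\alpha}(x)=e^{-\pi i|x|^2\cot\alpha}$. $e_{-\alpha}L^p(\mathbf{T}^n_\alpha)$ is the space of functions $f=e_{-\alpha}g$ on the cube with $g\in L^p(\mathbf{T}^n_\alpha)$;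 for such $f$, $e_\alpha f$ denotes the periodic function $g$. For $f\in e_{-\alpha}L^1(\mathbf{T}^n_\alpha)$ and $g\in L^1(\mathbf{T}^n)$ ($1$-periodic in each coordinate), the fractional convolution of order $\alpha$ is $$(f\overset{\alpha}{\ast}g)(x)=|\csc\alpha|^n e_{-\alpha}(x)\int_{\mathbf{T}^n_\alpha}e_\alpha(y)f(y)\,g\big((x-y)\csc\alpha\big)\,dy .$$ $F^n_N(x)=\prod_{j=1}^nF^1_N(x_j)$ with $F^1_N(t)=\sum_{j=-N}^N\big(1-\frac{|j|}{N+1}\big)e^{2\pi i jt}$ is the classical Fejér kernel. $\mathbb{Z}^+$ denotes the positive integers. *)

(* Defs.v *)
From HB Require Import structures.
From mathcomp Require Import all_boot all_order all_algebra.
From mathcomp Require Import complex.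
From mathcomp Require Import all_classical all_reals all_analysis.
From mathcomp Require Import measurable_realfun.

Set Implicit Arguments.
Unset Strict Implicit.
Unset Printing Implicit Defensive.

Import Order.TTheory GRing.Theory Num.Theory.
Import numFieldNormedType.Exports.

Local Open Scope classical_set_scope.
Local Open Scope ring_scope.
Local Open Scope complex_scope.

(* R^n, with the product (Borel) sigma-algebra. *)
Notation RT R n := (n.-tuple (measurableTypeR R)).

Section lebesgue_tuple.
Context {R : realType}.

Definition consRT n (z : measurableTypeR R * RT R n) : RT R n.+1 :=
  [the RT R n.+1 of z.1 :: z.2].

Definition unconsRT n (x : RT R n.+1) : measurableTypeR R * RT R n :=
  (thead x, [tuple of behead x]).

Lemma consRTK n : cancel (@consRT n) (@unconsRT n).
Proof.
by case=> a t; rewrite /unconsRT /consRT theadE; congr pair; exact/val_inj.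
Qed.

Lemma measurable_consRT n : measurable_fun setT (@consRT n).
Proof. exact: measurable_cons. Qed.

Lemma measurable_unconsRT n : measurable_fun setT (@unconsRT n).
Proof.
apply: measurable_fun_pair; first exact: measurable_tnth.
exact: measurable_behead.
Qed.

Section step.
Variables (n : nat) (m : {sigma_finite_measure set (RT R n) -> \bar R}).

Definition lebesgue_cons : set (RT R n.+1) -> \bar R :=
  pushforward (lebesgue_measure \x m)%E (@consRT n).

Let mcons_pre A : measurable A -> measurable (@consRT n @^-1` A).
Proof. by move=> mA; rewrite -[X in measurable X]setTI; exact: measurable_consRT. Qed.

Let lebesgue_cons0 : lebesgue_cons set0 = 0%E.
Proof. by rewrite /lebesgue_cons /pushforward preimage_set0 measure0. Qed.

Let lebesgue_cons_ge0 A : (0 <= lebesgue_cons A)%E.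
Proof. exact: (measure_ge0 (lebesgue_measure \x m)%E). Qed.

Let lebesgue_cons_sigma_additive : semi_sigma_additive lebesgue_cons.
Proof.
move=> F mF tF mUF; rewrite /lebesgue_cons /pushforward preimage_bigcup.
apply: measure_semi_sigma_additive => [k||]; first exact: mcons_pre.
  apply/trivIsetP => i j _ _ ij; rewrite -preimage_setI.
  by move/trivIsetP : tF => /(_ _ _ _ _ ij) ->//; rewrite preimage_set0.
by rewrite -preimage_bigcup; exact: mcons_pre.
Qed.

HB.instance Definition _ := isMeasure.Build _ _ _ lebesgue_cons
  lebesgue_cons0 lebesgue_cons_ge0 lebesgue_cons_sigma_additive.

Let sigma_finite_lebesgue_cons : sigma_finite setT lebesgue_cons.
Proof.
have /sigma_finiteP[F [TF ndF Foo]] :=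
  sigma_finiteT (@lebesgue_measure R : {sigma_finite_measure set _ -> \bar R}).
have /sigma_finiteP[G [TG ndG Goo]] := sigma_finiteT m.
exists (fun k => @unconsRT n @^-1` (F k `*` G k)).
  apply/seteqP; split=> // x _.
  have [i _ Fi] : (\bigcup_i F i) (unconsRT x).1 by rewrite -TF.
  have [j _ Gj] : (\bigcup_i G i) (unconsRT x).2 by rewrite -TG.
  exists (maxn i j) => //; split.
  - by move: Fi; exact/subsetPset/ndF/leq_maxl.
  - by move: Gj; exact/subsetPset/ndG/leq_maxr.
move=> k; have [mF Fk] := Foo k; have [mG Gk] := Goo k; split.
  rewrite -[X in measurable X]setTI; apply: measurable_unconsRT => //.
  exact: measurableX.
rewrite /lebesgue_cons /pushforward -comp_preimage.
rewrite (_ : _ \o _ = id) ?preimage_id; last first.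
  by apply/funext => z; exact: consRTK.
by rewrite product_measure1E// lte_mul_pinfty// ge0_fin_numE.
Qed.

HB.instance Definition _ :=
  Measure_isSigmaFinite.Build _ _ _ lebesgue_cons sigma_finite_lebesgue_cons.

End step.

Fixpoint lebesgue_tuple n : {sigma_finite_measure set (RT R n) -> \bar R} :=
  match n with
  | 0 => \d_([tuple] : RT R 0)
  | n'.+1 => lebesgue_cons (lebesgue_tuple n')
  end.

End lebesgue_tuple.

(* lebesgue_tuple n is the Lebesgue measure of R^n on Borel sets. *)
Lemma lebesgue_tuple_box (R : realType) n (A : 'I_n -> set (measurableTypeR R)) :
  (forall i, measurable (A i)) ->
  lebesgue_tuple n [set x | forall i, A i (tnth x i)] =
  (\prod_(i < n) lebesgue_measure (A i))%E.
Proof.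
elim: n A => [|n IHn] A mA.
  rewrite big_ord0 /= diracE mem_set//; by case.
rewrite big_ord_recl -(IHn (fun i => A (lift ord0 i)))//=.
rewrite /lebesgue_cons /pushforward -product_measure1E//; last first.
  rewrite (_ : mkset _ = \bigcap_(i in [set: 'I_n])
      ((fun x : RT R n => tnth x i) @^-1` A (lift ord0 i))); last first.
    by apply/seteqP; split=> x //= h i; [move=> _; exact: h | exact: h].
  apply: fin_bigcap_measurable => // i _.
  by rewrite -[X in measurable X]setTI; exact: measurable_tnth.
congr (product_measure1 _ _ _); apply/seteqP; split=> -[a t] /=.
  move=> h; split; first by have := h ord0; rewrite tnth0.
  by move=> i; have := h (lift ord0 i); rewrite tnthS.
move=> [h0 h] i; case: (unliftP ord0 i) => [j|] ->; last by rewrite tnth0.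
by rewrite tnthS.
Qed.

Section fractional_torus.
Context {R : realType}.
Implicit Types (alpha : R) (n N : nat) (p : \bar R).

Definition torus_side alpha : R := `|sin alpha|.

Definition torus_cube alpha n : set (RT R n) :=
  [set x | forall i, tnth x i \in `[- (torus_side alpha / 2), torus_side alpha / 2]].
Arguments torus_cube alpha n : clear implicits.

Lemma measurable_torus_cube alpha n : measurable (torus_cube alpha n).
Proof.
rewrite (_ : torus_cube alpha n = \bigcap_(i in [set: 'I_n])
    ((fun x : RT R n => tnth x i) @^-1`
      [set` `[- (torus_side alpha / 2), torus_side alpha / 2]])); last first.
  by apply/seteqP; split=> x //= h i; [move=> _; exact: h | exact: h].
apply: fin_bigcap_measurable => // i _.
by rewrite -[X in measurable X]setTI; exact: measurable_tnth.
Qed.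
Arguments measurable_torus_cube alpha n : clear implicits.

(* Lebesgue measure on the cube; integrals, norms and "almost everywhere" on
   the fractional torus refer to it. *)
Definition torus_measure alpha n : {measure set (RT R n) -> \bar R} :=
  mrestr (lebesgue_tuple n) (measurable_torus_cube alpha n).

Definition torus_periodic alpha n (V : Type) (f : RT R n -> V) : Prop :=
  forall (j : 'I_n) (x : RT R n),
    f [tuple tnth x i + (if i == j then torus_side alpha else 0) | i < n] = f x.

(* e^(i t) *)
Definition cexpi (t : R) : R[i] := cos t +i* sin t.

Definition cot alpha : R := cos alpha / sin alpha.
Definition csc alpha : R := (sin alpha)^-1.

Definition sqnorm n (x : RT R n) : R := \sum_(i < n) tnth x i ^+ 2.

(* e_alpha *)
Definition chirp alpha n (x : RT R n) : R[i] :=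
  cexpi (pi * sqnorm x * cot alpha).

(* e_(-alpha) *)
Definition chirpN alpha n (x : RT R n) : R[i] :=
  cexpi (- (pi * sqnorm x * cot alpha)).

Definition measurable_cfun n (f : RT R n -> R[i]) : Prop :=
  measurable_fun setT (fun x => complex.Re (f x)) /\
  measurable_fun setT (fun x => complex.Im (f x)).

Definition cabs n (f : RT R n -> R[i]) (x : RT R n) : \bar R :=
  (Normc.normc (f x))%:E.

Definition torus_Lnorm alpha n p (h : RT R n -> \bar R) : \bar R :=
  Lnorm (torus_measure alpha n) p h.

Definition torus_weakL1norm alpha n (h : RT R n -> \bar R) : \bar R :=
  ereal_sup [set (l%:E * torus_measure alpha n [set x | (l%:E < `|h x|)%E])%E
            | l in [set l : R | 0 < l]].

Definition torus_cLp alpha n p (g : RT R n -> R[i]) : Prop :=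
  [/\ torus_periodic alpha g, measurable_cfun g &
      (torus_Lnorm alpha p (cabs g) < +oo)%E].

Definition torus_Lp alpha n p (h : RT R n -> \bar R) : Prop :=
  [/\ torus_periodic alpha h, measurable_fun setT h &
      (torus_Lnorm alpha p h < +oo)%E].

Definition torus_weakL1 alpha n (h : RT R n -> \bar R) : Prop :=
  [/\ torus_periodic alpha h, measurable_fun setT h &
      (torus_weakL1norm alpha h < +oo)%E].

(* Equality almost everywhere: L^p functions are classes, and a function on
   the closed cube need not agree on opposite faces. *)
Definition chirp_Lp alpha n p (f : RT R n -> R[i]) : Prop :=
  exists2 g : RT R n -> R[i], torus_cLp alpha p g &
    f = (fun x => chirpN alpha x * g x) %[ae torus_measure alpha n].

(* Junk value 0 of Rintegral in a non-integrable component; for the integrands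
   used here (an L^1 function times a bounded kernel) both are integrable. *)
Definition cintegral n (mu : {measure set (RT R n) -> \bar R})
    (f : RT R n -> R[i]) : R[i] :=
  (\int[mu]_x complex.Re (f x)) +i* (\int[mu]_x complex.Im (f x)).

Definition frac_conv alpha n (f g : RT R n -> R[i]) (x : RT R n) : R[i] :=
  (`|csc alpha| ^+ n)%:C * chirpN alpha x *
  cintegral (torus_measure alpha n) (fun y =>
    chirp alpha y * f y *
    g [tuple (tnth x i - tnth y i) * csc alpha | i < n]).

(* The frequencies j = -N, ..., N are written j = k - N with k < 2N + 1. *)
Definition fejer1 N (t : R) : R[i] :=
  \sum_(k < N.*2.+1) let j : int := k%:Z - N%:Z in
    (1 - `|j|%:~R / N.+1%:R)%:C * cexpi (2 * pi * j%:~R * t).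

Definition fejer n N (x : RT R n) : R[i] := \prod_(j < n) fejer1 N (tnth x j).

(* Extended-real valued: the supremum is only finite almost everywhere. *)
Definition frac_maximal alpha n (f : RT R n -> R[i]) (x : RT R n) : \bar R :=
  ereal_sup [set cabs (frac_conv alpha f (@fejer n N)) x
            | N in [set N : nat | (0 < N)%N]].

End fractional_torus.

Arguments fejer {R} n N x.

(* Main.v *)
Require Import Defs.
From mathcomp Require Import all_boot all_order all_algebra.
From mathcomp Require Import complex.
From mathcomp Require Import all_classical all_reals all_analysis.
From mathcomp Require Import measurable_realfun ess_sup_inf.
From mathcomp Require Import ring lra zify.
Import Order.TTheory GRing.Theory Num.Theory.
Import numFieldNormedType.Exports.
Local Open Scope classical_set_scope.
Local Open Scope ring_scope.
Set Implicit Arguments.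
Unset Strict Implicit.
Unset Printing Implicit Defensive.

(** Write f = e_(-alpha) g, let s = |sin alpha|, and let K_N(x, y) be the product over the
coordinates of the real Fejer kernels F_N((x_i - y_i) / s). As F_N is even and chirps have
modulus 1, the fractional convolution of f with the Fejer kernel is, up to the factor
e_(-alpha)(x), the Fejer mean s^-n int g(y) K_N(x, y) dy. Everything thus reduces to Fejer
means on a torus of side s.

The kernel K_N has no integrable radially decreasing majorant when n > 1, so that the maximal
function over cubes does not control its means. Instead, if 2^m <= N + 1 < 2^(m+1), then in one
variable F_N(t) is at most 36 2^m 4^-i as soon as the distance from t to the integers is at
least of order 2^(i-m). By the one-third trick, two points of the circle within 2^(-l) / 3 of
each other lie in a common dyadic arc of length 2^(-l), in the standard dyadic grid or in its
translate by -1/3. Hence F_N is dominated by a sum over i and over the two grids of 2^m 4^-i times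
the indicator of a dyadic arc of length 2^(i-m) (rfejer_dom); multiplying over the coordinates,
K_N(x, .) is dominated by a sum, over exponents i_1, ..., i_n and grids, of indicators of dyadic
boxes, with coefficients at most a constant times the product of the 2^(-i_j), over the
measure of the box (fejer_kernel_dom).

For fixed exponents and grids these boxes form, as m varies, a nested sequence of partitions, and
the maximal function of averages over the atoms of such a sequence is of weak type (1,1) with
constant 1: stop at the first atom with a large average (doob_weak). Allowing averages as large
as l (3/2)^(i_1 + ... + i_n) keeps the total mean below a constant times l, since
the series of (3/4)^i converges, and the exceptional sets sum up, since the series of (2/3)^i
converges. This gives the weak type (1,1) bound of the Fejer maximal function (weak_type) and
its bound on L^infinity (fejer_maximal_le). The case 1 < p < infinity follows by Marcinkiewicz
interpolation, in a version with the dyadic levels eta 2^k, where eta then tends to 0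
(interpolation).

For the almost everywhere convergence, the weak type bound makes the class of integrable functions
with convergent means closed in L^1 (fejer_convergent_closed). It contains the indicators of boxes
with lower-unbounded sides, because their means are products of one-dimensional
integrals of F_N, whose mass is 1 and concentrates at 0. These boxes are a pi-system
that generates the Borel sets, so the class contains all indicators, then all simple functions, and
then all of L^1. *)

(** * Maximal inequalities and interpolation on a measure space *)

Section abstract_measure.
Import HBNNSimple.
Local Open Scope ereal_scope.
Context d (T : measurableType d) (R : realType).
Variable mu : {measure set T -> \bar R}.

(** The integral of a function of any sign is defined from suprema over the simple functions below
its positive and negative parts; multiplying a simple function by the indicator of the complement
of a measurable null set does not change its integral. Measurability matters here because an
element of a chirped Lebesgue space is only almost everywhere equal to a Borel function. *)
Lemma ae_eq_integral_nonmeasurable (f g : T -> \bar R) :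
  f = g %[ae mu] -> \int[mu]_x f x = \int[mu]_x g x.
Proof.
wlog suff H : f g / (forall x, 0 <= f x) -> (forall x, 0 <= g x) ->
    f = g %[ae mu] -> \int[mu]_x f x <= \int[mu]_x g x.
  have E (u v : T -> \bar R) : (forall x, 0 <= u x) -> (forall x, 0 <= v x) ->
      u = v %[ae mu] -> \int[mu]_x u x = \int[mu]_x v x.
    move=> u0 v0 uv; apply/eqP; rewrite eq_le !H//.
    by apply: filterS uv => x h _; rewrite h.
  move=> /ae_eq_funeposneg[fgp fgn].
  by rewrite [LHS]integralE [RHS]integralE; congr (_ - _); exact: E.
move=> f0 g0 [N [mN N0 fgN]].
rewrite ge0_integralTE//; apply: ge_ereal_sup => _ [h /= hf <-].
rewrite -integralT_nnsfun.
pose h1 := mul_nnsfun h (indic_nnsfun R (measurableC mN)).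
have h1E x : h1 x = (h x * \1_(~` N) x)%R by [].
have -> : \int[mu]_x (h x)%:E = \int[mu]_x (h1 x)%:E.
  apply: ae_eq_integral => //; [exact/measurable_EFinP|exact/measurable_EFinP|].
  exists N; split => // x /= /not_implyP[_]; apply: contra_notP => nN.
  by rewrite -[RHS]/((h1 x)%:E) h1E indicE mem_set ?mulr1.
rewrite integralT_nnsfun ge0_integralTE//; apply: ereal_sup_ubound.
exists h1 => //= x; rewrite -[X in X <= _]/((h1 x)%:E) h1E indicE.
have [nN|nN] := pselect (N x).
  by rewrite memNset ?mulr0//= => /(_ nN).
rewrite mem_set// mulr1; apply: le_trans (hf x) _.
suff -> : f x = g x by [].
by apply: contrapT => fg; apply: nN; apply: fgN => /= /(_ Logic.I).
Qed.

Section doob.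
Variables (c : nat -> T -> nat).
Hypothesis mc : forall m k, measurable (c m @^-1` [set k]).
Hypothesis nest : forall m x y, c m.+1 x = c m.+1 y -> c m x = c m y.
Variables (u : T -> \bar R) (l : R).
Hypothesis (meas_u : measurable_fun setT u) (u0 : forall x, 0 <= u x) (l0 : (0 <= l)%R).

Definition atom m x : set T := c m @^-1` [set c m x].

(** The average of [u] over the atom of [x] exceeds [l]; the multiplied form makes sense
for atoms of measure zero or infinity. *)
Definition large_atom m x := l%:E * mu (atom m x) < \int[mu]_(y in atom m x) u y.

Let nest_le m m' x y : (m <= m')%N -> c m' x = c m' y -> c m x = c m y.
Proof.
elim: m' => [|m' IH]; first by rewrite leqn0 => /eqP->.
by rewrite leq_eqVlt => /predU1P[->//|/IH H /nest].
Qed.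

(** The stopping rule: points of the atom with label [k] at level [m] that lie in no large
atom of a coarser level. Nestedness makes this set either empty or the whole atom. *)
Let first_atom m k : set T :=
  [set x | [/\ c m x = k, large_atom m x & forall m', (m' < m)%N -> ~ large_atom m' x]].

Let atomE m x y : c m x = c m y -> atom m x = atom m y.
Proof. by move=> E; rewrite /atom E. Qed.

Let first_atomP m k :
  first_atom m k = set0 \/ exists2 x, large_atom m x & first_atom m k = atom m x.
Proof.
have [->|/set0P[x [xk lx fx]]] := eqVneq (first_atom m k) set0; first by left.
right; exists x => //; apply/seteqP; split => y /=.
  by move=> [yk _ _]; rewrite /atom /= yk.
rewrite /atom /= => yx; split; first by rewrite yx.
- by rewrite /large_atom (atomE yx).
- move=> m' m'm; rewrite /large_atom (atomE (nest_le (ltnW m'm) yx)).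
  exact: fx.
Qed.

Let mfirst m k : measurable (first_atom m k).
Proof. by have [->|[x _ ->]] := first_atomP m k; [|exact: mc]. Qed.

Let first_le m k : l%:E * mu (first_atom m k) <= \int[mu]_(y in first_atom m k) u y.
Proof.
have [->|[x lx ->]] := first_atomP m k; last exact: ltW.
by rewrite measure0 mule0 integral_set0.
Qed.

Let F (j : nat) := if @pickle_inv (nat * nat)%type j is Some p then first_atom p.1 p.2 else set0.

Let mF j : measurable (F j).
Proof. by rewrite /F; case: pickle_inv => // p; exact: mfirst. Qed.

Let largeE : [set x | exists m, large_atom m x] = \bigcup_j F j.
Proof.
apply/seteqP; split => x /=.
  move=> [m0 lm]; have exm : exists m, `[< large_atom m x >] by exists m0; apply/asboolP.
  case: (ex_minnP exm) => m /asboolP lx mmin.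
  exists (pickle (m, c m x)) => //; rewrite /F pickleK_inv /=; split => //.
  by move=> m' m'm /asboolP /mmin; rewrite leqNgt m'm.
by move=> [j _]; rewrite /F; case: pickle_inv => // -[m k] /= [_ lx _]; exists m.
Qed.

Lemma measurable_large_atom : measurable [set x | exists m, large_atom m x].
Proof. by rewrite largeE; exact: bigcup_measurable. Qed.

(** Doob's maximal inequality for a nested sequence of countable partitions. Each point with a
large average is charged to its coarsest large atom; these atoms are pairwise disjoint, and on each
of them the inequality holds by definition. *)
Lemma doob_weak : l%:E * mu [set x | exists m, large_atom m x] <= \int[mu]_x u x.
Proof.
rewrite largeE.
have tF : trivIset setT F.
  apply/trivIsetP => i j _ _ ij; apply/seteqP; split => // x [].
  rewrite /F.
  have := @pickle_invK (nat * nat)%type i; have := @pickle_invK (nat * nat)%type j.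
  case: pickle_inv => [[m' k']|//]; case: pickle_inv => [[m k]|//] /= pj pi.
  move=> [a b e] [a' b' e']; move/eqP: ij; apply.
  have mm : m = m' by have [/e'//|/e//|->] := ltngtP m m'.
  by rewrite -pi -pj -a -a' mm.
rewrite measure_bigcup// -nneseriesZl//.
apply: (@le_trans _ _ (\sum_(0 <= i <oo | i \in setT) \int[mu]_(y in F i) u y)).
  apply: lee_nneseries => [i _ _|i _]; first by rewrite mule_ge0.
  rewrite /F; case: pickle_inv => [[m k]|]; last by rewrite measure0 mule0 integral_set0.
  exact: first_le.
rewrite (eq_eseriesl (Q := xpredT)); last by move=> i; rewrite in_setT.
rewrite -ge0_integral_bigcup//; last exact: measurable_funTS.
by apply: ge0_subset_integral => //; exact: bigcup_measurable.
Qed.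

End doob.


Lemma measurable_nneseries (h : nat -> T -> \bar R) :
  (forall k x, 0 <= h k x) -> (forall k, measurable_fun setT (h k)) ->
  measurable_fun setT (fun x => \sum_(0 <= k <oo) h k x).
Proof. by move=> h0 mh; apply: (@ge0_emeasurable_sum _ _ _ setT h xpredT). Qed.

Lemma powRX (x r : R) k : (0 <= x -> (x ^+ k) `^ r = (x `^ r) ^+ k)%R.
Proof.
move=> x0; elim: k => [|k IH]; first by rewrite !expr0 powR1.
by rewrite !exprS (powRM _ x0 (exprn_ge0 k x0)) IH.
Qed.

(** The largest term is at most [v] and the terms decrease geometrically from there, whatever
the number of terms. *)
Lemma geometric_below (r b v : R) (P : pred nat) (K : nat) :
  (1 < r)%R -> (0 <= b)%R -> (0 <= v)%R ->
  (forall i j, (i <= j)%N -> P j -> P i) -> (forall k, P k -> (b * r ^+ k <= v)%R) ->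
  (\sum_(k < K) (if P k then b * r ^+ k else 0) <= r / (r - 1) * v)%R.
Proof.
move=> r1 b0 v0 dP H; have r10 : (0 < r - 1)%R by rewrite subr_gt0.
have c0 : (0 <= r / (r - 1))%R by rewrite divr_ge0 ?ltW// (lt_trans ltr01).
elim: K => [|K IH]; first by rewrite big_ord0 mulr_ge0.
have [PK|PK] := boolP (P K); last by rewrite big_ord_recr /= (negbTE PK) addr0.
apply: le_trans (ler_wpM2l c0 (H _ PK)).
rewrite (eq_bigr (fun k : 'I_K.+1 => b * r ^+ k)%R); last first.
  by move=> k _; rewrite (dP k K)// -ltnS.
rewrite -mulr_sumr -[leLHS](mulfK (lt0r_neq0 r10)) mulrAC -mulrA -mulrA [leRHS]mulrCA.
rewrite ler_wpM2l// mulrA mulrAC [leRHS]mulrAC ler_wpM2r ?invr_ge0 ?ltW//.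
by rewrite mulrC -subrX1 exprS gtrBl ltr01.
Qed.

Section interpolation.
Variables (u : T -> R) (v : T -> \bar R) (a D p : R).
Hypotheses (meas_u : measurable_fun setT u) (u0 : forall x, (0 <= u x)%R).
Hypotheses (mv : measurable_fun setT v) (v0 : forall x, 0 <= v x).
Hypotheses (a0 : (0 < a)%R) (D0 : (0 <= D)%R) (p1 : (1 < p)%R).
Hypothesis mufin : mu setT < +oo.
Hypothesis level : forall l : R, (0 < l)%R ->
  l%:E * mu [set x | (a * l)%:E < v x] <= D%:E * \int[mu]_(x in [set x | (l < u x)%R]) (u x)%:E.

Let lev (eta : R) k : R := (eta * 2 ^+ k)%R.

Let lev_gt0 eta k : (0 < eta)%R -> (0 < lev eta k)%R.
Proof. by move=> h; rewrite mulr_gt0// exprn_gt0. Qed.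

Let p0 : (0 < p)%R. Proof. exact: lt_trans p1. Qed.

Let above (eta : R) (y : \bar R) k : \bar R := if (a * lev eta k)%R%:E < y then 1 else 0.

Let above_ge0 eta y k : 0 <= above eta y k.
Proof. by rewrite /above; case: ifP. Qed.

(** A discrete layer-cake bound: [y ^ p] is at most the term of the last level below [y], or
is already bounded by the lowest level. An infinite [y] makes all terms of the series present, so
that both sides are infinite. *)
Lemma poweR_dyadic (eta : R) (y : \bar R) : (0 < eta)%R -> 0 <= y ->
  y `^ p <= ((a * eta) `^ p)%:E +
    \sum_(0 <= k <oo) ((2 * a * lev eta k) `^ p)%:E * above eta y k.
Proof.
move=> eta0 y0.
have t0 k : 0 <= ((2 * a * lev eta k) `^ p)%:E * above eta y k.
  by rewrite mule_ge0 ?lee_fin ?powR_ge0.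
have ge_term k : ((2 * a * lev eta k) `^ p)%:E * above eta y k <=
   \sum_(0 <= k <oo) ((2 * a * lev eta k) `^ p)%:E * above eta y k.
  apply: le_trans (nneseries_lim_ge k.+1 _) => //.
  by rewrite big_nat_recr//= leeDr// sume_ge0.
(* The levels are unbounded. *)
have unb (r : R) : exists k, (r < lev eta k)%R.
  have [k] : exists k, (r / eta < 2 ^+ k)%R.
    exists (Num.bound `|r / eta|%R).
    apply: lt_le_trans (_ : (Num.bound `|r / eta|%R)%:R <= _)%R.
      by apply: le_lt_trans (ler_norm _) _; exact: (archi_boundP (normr_ge0 _)).
    by rewrite -natrX ler_nat ltnW// ltn_expl.
  by rewrite ltr_pdivrMr// mulrC => h; exists k.
case: y y0 t0 ge_term => [y| |//] y0 t0 ge_term.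
  rewrite lee_fin in y0; rewrite poweR_EFin.
  have [ya|ya] := leP y (a * eta)%R.
    rewrite -[X in X <= _]adde0 leeD ?nneseries_ge0// lee_fin ge0_ler_powR ?nnegrE//.
    by rewrite ltW// (lt_trans ltr01).
    by rewrite mulr_ge0 ?ltW.
  have [k0 hk0] := unb (y / a)%R.
  have exk : exists k, (y <= a * lev eta k)%R.
    by exists k0; rewrite mulrC -ler_pdivrMr// ltW.
  case: (ex_minnP exk) => -[|k] yk mink.
    by move: yk; rewrite /lev expr0 mulr1 leNgt ya.
  apply: (@le_trans _ _ (((2 * a * lev eta k) `^ p)%:E)).
    rewrite lee_fin ge0_ler_powR ?nnegrE ?(ltW p0)//.
      by rewrite !mulr_ge0// ?ltW// lev_gt0.
    by move: yk; rewrite /lev exprS; nra.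
  rewrite -[X in X <= _]add0e leeD ?lee_fin ?powR_ge0//.
  apply: le_trans (ge_term k).
  rewrite /above; have -> : (a * lev eta k)%:E < y%:E.
    by rewrite lte_fin ltNge; apply/negP => /mink; rewrite ltnn.
  by rewrite mule1.
suff -> : \sum_(0 <= k <oo) ((2 * a * lev eta k) `^ p)%:E * above eta +oo k = +oo.
  by rewrite addey// leey.
apply/eqyP => A A0.
have [k hk] := unb (A `^ p^-1 / (2 * a))%R.
apply: le_trans (ge_term k); rewrite /above ltry mule1 lee_fin.
have -> : A = ((A `^ p^-1) `^ p)%R by rewrite -powRrM mulVf ?gt_eqF// powRr1// ltW.
rewrite ge0_ler_powR ?nnegrE ?powR_ge0 ?(ltW p0)//.
  by rewrite !mulr_ge0// ?ltW// lev_gt0.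
by rewrite ltW// mulrC -ltr_pdivrMr// mulr_gt0.
Qed.

Let c := (2 `^ (p - 1) / (2 `^ (p - 1) - 1))%R.

Let r1 : (1 < 2 `^ (p - 1) :> R)%R.
Proof.
rewrite -[ltLHS](powRr0 2) /powR ifF ?ifF; try by apply/negbTE; rewrite pnatr_eq0.
by rewrite ltr_expR ltr_pM2r ?subr_gt0// ln_gt0// ltr1n.
Qed.

Let c0 : (0 <= c)%R.
Proof. by rewrite divr_ge0 ?powR_ge0// subr_ge0 ltW. Qed.

(** This is where [1 < p] enters: the levels below [y] contribute a geometric series of ratio
[2 ^ (p - 1)], dominated by its last term. *)
Lemma dyadic_sum_le (eta y : R) : (0 < eta)%R -> (0 <= y)%R ->
  \sum_(0 <= k <oo) (if (lev eta k < y)%R then lev eta k `^ (p - 1) * y else 0)%R%:E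
    <= (c * y `^ p)%:E.
Proof.
move=> eta0 y0; apply: lime_le.
  by apply: is_cvg_nneseries => k _ _; case: ifP; rewrite lee_fin// mulr_ge0 ?powR_ge0.
near=> K; rewrite sumEFin lee_fin big_mkord.
rewrite -(mulr_powRB1 y0 p0) mulrCA mulrC.
under eq_bigr => k _ do rewrite -(mul0r y) -(fun_if (fun z => z * y)%R).
rewrite -mulr_suml ler_wpM2r//.
have E k : (lev eta k `^ (p - 1) = eta `^ (p - 1) * (2 `^ (p - 1)) ^+ k)%R.
  by rewrite (powRM _ (ltW eta0) (exprn_ge0 k _)) ?powRX ?ler0n.
under eq_bigr => k _ do rewrite E.
apply: (@geometric_below _ _ _ (fun k => lev eta k < y)%R) => [|||i j ij|k ky];
  rewrite ?powR_ge0//.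
  by apply: le_lt_trans; rewrite /lev ler_wpM2l ?(ltW eta0)// ler_weXn2l// ler1n.
rewrite -E ge0_ler_powR ?nnegrE ?subr_ge0 ?(ltW p1)//; last exact: ltW.
by rewrite ltW ?lev_gt0.
Unshelve. all: by end_near. Qed.

Let B : R := ((2 * a) `^ p * D * c)%R.

(** Integrating [poweR_dyadic] at [v x] and applying the level estimate turns each level into an
integral of [u] over the points where [u] exceeds that level; summing over the levels under the
integral gives [u ^ p]. *)
Lemma interpolation_eta (eta : R) : (0 < eta)%R ->
  \int[mu]_x (v x `^ p) <= ((a * eta) `^ p)%:E * mu setT +
    B%:E * \int[mu]_x (u x `^ p)%:E.
Proof.
move=> eta0.
have mA k : measurable [set x | (a * lev eta k)%:E < v x].
  by rewrite -[X in measurable X]setTI; exact: emeasurable_fun_o_infty.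
have mU k : measurable [set x | (lev eta k < u x)%R].
  rewrite (_ : mkset _ = u @^-1` `]lev eta k, +oo[); last first.
    by apply/seteqP; split => x /=; rewrite in_itv/= andbT.
  by rewrite -[X in measurable X]setTI; exact: meas_u.
have aboveE k : (fun x => above eta (v x) k) = (fun x => (\1_[set x | ((a * lev eta k)%:E < v x)%E] x)%:E).
  apply/funext => x; rewrite /above indicE; case: ifPn => h; first by rewrite mem_set.
  by rewrite memNset//; exact/negP.
have mab k : measurable_fun setT (fun x => above eta (v x) k).
  by rewrite aboveE; apply/measurable_EFinP; exact: measurable_indic.
have ab0 k x : 0 <= above eta (v x) k by [].
apply: (@le_trans _ _ (\int[mu]_x (((a * eta) `^ p)%:E +
    \sum_(0 <= k <oo) ((2 * a * lev eta k) `^ p)%:E * above eta (v x) k))).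
  apply: ge0_le_integral => //.
  - by move=> x _; rewrite poweR_ge0.
  - exact: (measurableT_comp (@measurable_poweR R p) mv).
  - apply: emeasurable_funD => //; apply: measurable_nneseries => [k x|k]; last exact: measurable_funeM.
    by rewrite mule_ge0// lee_fin powR_ge0.
  - by move=> x _; exact: poweR_dyadic.
rewrite ge0_integralD//; last 3 first.
- by move=> x _; rewrite lee_fin powR_ge0.
- by move=> x _; apply: nneseries_ge0 => k _ _; rewrite mule_ge0// lee_fin powR_ge0.
- apply: measurable_nneseries => [k x|k]; last exact: measurable_funeM.
  by rewrite mule_ge0// lee_fin powR_ge0.
rewrite integral_cst// leeD2l// integral_nneseries//; last 2 first.
- by move=> k; apply: measurable_funeM.
- by move=> k x _; rewrite mule_ge0// lee_fin powR_ge0.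
pose h k x := (if (lev eta k < u x)%R then lev eta k `^ (p - 1) * u x else 0)%R%:E.
have h0 k x : 0 <= h k x by rewrite /h; case: ifP => _; rewrite lee_fin// mulr_ge0// powR_ge0.
have hE k x : h k x = (lev eta k `^ (p - 1))%:E * ((EFin \o u) \_ [set x | (lev eta k < u x)%R]) x.
  rewrite /h patchE; case: ifPn => ky; first by rewrite mem_set// EFinM.
  by rewrite memNset ?mule0//; exact/negP.
have mh k : measurable_fun setT (h k).
  have -> : h k = (fun x => (lev eta k `^ (p - 1))%:E *
      ((EFin \o u) \_ [set x | (lev eta k < u x)%R]) x) by apply/funext => x; exact: hE.
  apply: measurable_funeM; apply/(measurable_restrictT _ (mU k)).
  by apply: measurable_funTS; exact/measurable_EFinP.
apply: (@le_trans _ _ (\sum_(0 <= k <oo) ((2 * a) `^ p * D)%:E * \int[mu]_x h k x)).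
  apply: lee_nneseries => k; first by move=> _ _; apply: integral_ge0 => x _; rewrite mule_ge0// lee_fin powR_ge0.
  move=> _.
  rewrite ge0_integralZl_EFin ?powR_ge0//.
  rewrite aboveE integral_indic// setIT.
  under eq_integral do rewrite hE.
  rewrite ge0_integralZl_EFin ?powR_ge0//; last 2 first.
    by move=> x _; rewrite patchE; case: ifP => // _; rewrite lee_fin.
    apply/(measurable_restrictT _ (mU k)).
    by apply: measurable_funTS; exact/measurable_EFinP.
  rewrite -integral_mkcond.
  have l0 : (0 <= lev eta k)%R by rewrite ltW ?lev_gt0.
  rewrite powRM//; last by rewrite mulr_ge0// ltW.
  rewrite -(mulr_powRB1 l0 p0).
  rewrite muleA -EFinM.
  rewrite (mulrC (lev eta k)) mulrA (mulrAC _ D) EFinM [in leRHS]EFinM -2!muleA.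
  apply: lee_wpmul2l; first by rewrite lee_fin mulr_ge0 ?powR_ge0.
  by apply: level; exact: lev_gt0.
rewrite nneseriesZl; last by move=> k _; exact: integral_ge0.
rewrite -integral_nneseries//.
rewrite /B (EFinM _ c) -muleA lee_wpmul2l ?lee_fin ?mulr_ge0 ?powR_ge0//.
rewrite -ge0_integralZl_EFin//; last 2 first.
- by move=> x _; rewrite lee_fin powR_ge0.
- by apply/measurable_EFinP; exact: (measurableT_comp (@measurable_powR R p) meas_u).
apply: ge0_le_integral => //.
- by move=> x _; exact: nneseries_ge0.
- by apply: measurable_nneseries.
- by apply: measurable_funeM; apply/measurable_EFinP; exact: (measurableT_comp (@measurable_powR R p) meas_u).
- by move=> x _; rewrite -EFinM; exact: dyadic_sum_le.
Qed.

(** Marcinkiewicz interpolation in the form needed for a sublinear operator bounded on L^infinity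
and of weak type (1,1), whose two properties are summarised by the hypothesis [level]. Since the
measure is finite, the contribution of the values below the lowest level vanishes with [eta]. *)
Lemma interpolation :
  \int[mu]_x (v x `^ p) <= B%:E * \int[mu]_x (u x `^ p)%:E.
Proof.
apply/lee_addgt0Pr => e e0.
(* [eta] is chosen so that the lowest level contributes at most [e]; the 1 avoids a division by 0. *)
pose M := (fine (mu setT) + 1)%R.
have M0 : (0 < M)%R by rewrite ltr_wpDl// fine_ge0.
pose eta := ((e / M) `^ p^-1 / a)%R.
have eM : (0 < e / M)%R by rewrite divr_gt0.
have eta0 : (0 < eta)%R by rewrite divr_gt0// powR_gt0.
apply: le_trans (interpolation_eta eta0) _.
rewrite addeC leeD2l// /eta mulrC divfK ?gt_eqF// -powRrM mulVf ?gt_eqF// powRr1 ?(ltW eM)//.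
rewrite -[mu setT]fineK ?ge0_fin_numE// -EFinM lee_fin.
by rewrite mulrAC ler_pdivrMr// ler_wpM2l ?(ltW e0)// lerDl.
Qed.

End interpolation.
End abstract_measure.

(** * The Fejer kernel in one variable and its dyadic domination *)

Section fejer_one_variable.
Context {R : realType}.
Implicit Types (t a b x : R) (N m l : nat) (s : bool).

(** The Fejer kernel as a real function: the sine parts cancel. *)
Definition rfejer N t : R :=
  \sum_(k < N.*2.+1) let j : int := k%:Z - N%:Z in
    (1 - `|j|%:~R / N.+1%:R) * cos (2 * pi * j%:~R * t).

Lemma sum_symmetric_range (V : zmodType) (G : int -> V) N :
  \sum_(k < N.*2.+1) G (k%:Z - N%:Z) =
  G 0 + \sum_(i < N) (G (i.+1%:Z) + G (- (i.+1%:Z))).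
Proof.
rewrite -(big_mkord xpredT (fun k => G (k%:Z - N%:Z))).
rewrite (big_cat_nat (n := N)) //=; last by rewrite -addnn -addSn leq_addl.
rewrite big_nat_rev /= add0n -[X in _ + \sum_(X <= _ < _) _]add0n big_addn.
have -> : (N.*2.+1 - N = N.+1)%N by rewrite -addnn -addSn addnK.
rewrite big_nat_recl //= addrCA; congr (_ + _).
  by rewrite add0n subrr.
rewrite !big_mkord addrC -big_split /=; apply: eq_bigr => i _; congr (G _ + G _).
  by rewrite PoszD addrK.
by have := ltn_ord i; lia.
Qed.

Lemma fejer1E N t : fejer1 N t = (rfejer N t)%:C%C.
Proof.
rewrite /fejer1 /rfejer.
rewrite (sum_symmetric_range (fun j : int => (1 - `|j|%:~R / N.+1%:R)%:C%C * cexpi (2 * pi * j%:~R * t))).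
rewrite (sum_symmetric_range (fun j : int => (1 - `|j|%:~R / N.+1%:R) * cos (2 * pi * j%:~R * t))).
rewrite [RHS](rmorphD (real_complex R)) (rmorph_sum (real_complex R)) /=; congr (_ + _).
  by rewrite /cexpi mulr0 mul0r cos0 sin0 !mulr1.
apply: eq_bigr => i _; rewrite normrN mulrNz mulrN mulNr.
rewrite /cexpi cosN sinN; apply/eqP.
by rewrite eq_complex /= !mul0r !subr0 !addr0 mulrN subrr !eqxx.
Qed.

Lemma rfejerE N t : N.+1%:R * rfejer N t =
  N.+1%:R + 2 * \sum_(i < N) (N - i)%:R * cos (2 * i.+1%:R * (pi * t)).
Proof.
rewrite /rfejer (sum_symmetric_range (fun j : int => (1 - `|j|%:~R / N.+1%:R) * cos (2 * pi * j%:~R * t))).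
rewrite mulrDr normr0 mul0r subr0 mul1r mulr0 mul0r cos0 mulr1; congr (_ + _).
rewrite !mulr_sumr; apply: eq_bigr => i _.
rewrite normrN mulrNz mulrN mulNr cosN.
have -> : `|i.+1%:Z|%:~R = i.+1%:R :> R by [].
have -> : 2 * pi * i.+1%:~R * t = 2 * i.+1%:R * (pi * t) by rewrite -!mulrA; congr (_ * _); rewrite mulrCA.
rewrite natrB ?(ltnW (ltn_ord i))//.
have : N.+1%:R != 0 :> R by rewrite pnatr_eq0.
set z := cos _; rewrite -!natr1 => H.
by field.
Qed.

(** The Dirichlet kernel in closed form, by telescoping. *)
Lemma dirichlet_sin N a :
  (1 + 2 * \sum_(i < N) cos (2 * i.+1%:R * a)) * sin a = sin (N.*2.+1%:R * a).
Proof.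
elim: N => [|N IH]; first by rewrite big_ord0 mulr0 addr0 !mul1r.
rewrite big_ord_recr /= mulrDr addrA mulrDl IH.
have -> : N.+1.*2.+1%:R * a = 2 * N.+1%:R * a + a.
  by rewrite -muln2 -addn1 natrD natrM; ring.
have -> : N.*2.+1%:R * a = 2 * N.+1%:R * a - a.
  by rewrite -muln2 -addn1 natrD natrM -natr1; ring.
rewrite sinB [in RHS]sinD; ring.
Qed.

(** The closed form of the Fejer kernel without division, by induction on [N]: the difference of
two consecutive left-hand sides is a Dirichlet kernel. *)
Lemma rfejer_sin N t :
  N.+1%:R * rfejer N t * sin (pi * t) ^+ 2 = sin (N.+1%:R * (pi * t)) ^+ 2.
Proof.
rewrite rfejerE; set a := pi * t.
elim: N => [|N IH]; first by rewrite big_ord0 mulr0 addr0 !mul1r.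
have -> : N.+2%:R + 2 * \sum_(i < N.+1) (N.+1 - i)%:R * cos (2 * i.+1%:R * a) =
   (N.+1%:R + 2 * \sum_(i < N) (N - i)%:R * cos (2 * i.+1%:R * a)) +
   (1 + 2 * \sum_(i < N.+1) cos (2 * i.+1%:R * a)).
  rewrite addrACA -mulrDr natr1; congr (_ + _ * _).
  rewrite !big_ord_recr /= subSnn mul1r addrA; congr (_ + _).
  rewrite -big_split /=; apply: eq_bigr => i _.
  by rewrite subSn 1?ltnW// -natr1 mulrDl mul1r.
rewrite mulrDl IH (expr2 (sin a)) [X in _ + X]mulrA dirichlet_sin.
have -> : N.+1.*2.+1%:R * a = N.+1%:R * a + N.+2%:R * a.
  by rewrite -mulrDl -natrD; congr (_%:R * _); lia.
set y := N.+1%:R * a.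
have -> : N.+2%:R * a = y + a by rewrite -natr1 mulrDl mul1r.
rewrite -[X in X + _ = _]mulr1 -(cos2Dsin2 a) !sinD !cosD; ring.
Qed.


Lemma cosDz x (m : int) : cos (x + 2 * pi * m%:~R) = cos x.
Proof.
have E (n : nat) (y : R) : cos (y + 2 * pi * n%:R) = cos y.
  by rewrite -[RHS](periodicn (@cosD2pi R) n y) -(mulr_natr (_ *+ 2)) -(mulr_natl pi 2).
case: m => n; first exact: E.
by rewrite NegzE mulrNz mulrN -(E n.+1 (x - _)) subrK.
Qed.

Lemma sinDz x (m : int) : sin (x + 2 * pi * m%:~R) = sin x.
Proof.
by rewrite -!cosBpihalf addrAC cosDz.
Qed.

Lemma rfejerDz N t (e : int) : rfejer N (t + e%:~R) = rfejer N t.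
Proof.
apply: eq_bigr => k _ /=; congr (_ * _).
rewrite mulrDr -[RHS](cosDz _ ((k%:Z - N%:Z) * e)); congr (cos (_ + _)).
by rewrite rmorphM /= mulrA.
Qed.

Lemma rfejerN N t : rfejer N (- t) = rfejer N t.
Proof. by apply: eq_bigr => k _ /=; rewrite mulrN cosN. Qed.

Lemma rfejer_le N t : rfejer N t <= N.*2.+1%:R.
Proof.
rewrite -[N.*2.+1 in leRHS]card_ord -sumr_const; apply: ler_sum => k _ /=.
have h : `|k%:Z - N%:Z| <= N.+1%:Z by have := ltn_ord k; lia.
have h2 : 0 <= `|k%:Z - N%:Z|%:~R / N.+1%:R :> R.
  by rewrite divr_ge0 // ler0z.
have h3 : `|k%:Z - N%:Z|%:~R / N.+1%:R <= 1 :> R.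
  by rewrite ler_pdivrMr ?ltr0n// mul1r -(ler_int R) in h *.
have := cos_le1 (2 * pi * (k%:Z - N%:Z)%:~R * t).
set c := cos _; set w := _ / _ in h2 h3 *; nra.
Qed.

Lemma rfejer_ge0 N t : 0 <= rfejer N t.
Proof.
have N0 : 0 < N.+1%:R :> R by rewrite ltr0n.
have [s0|s0] := eqVneq (sin (pi * t)) 0; last first.
  have : 0 <= N.+1%:R * rfejer N t * sin (pi * t) ^+ 2.
    by rewrite rfejer_sin sqr_ge0.
  by rewrite pmulr_lge0 ?exprn_even_gt0// pmulr_rge0.
rewrite -(pmulr_rge0 _ N0) rfejerE addr_ge0 ?ler0n// mulr_ge0//.
apply: sumr_ge0 => i _; rewrite mulr_ge0 ?ler0n//.
have H (m : nat) : sin (m%:R * (pi * t)) = 0.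
  elim: m => [|m IH]; first by rewrite mul0r sin0.
  by rewrite -natr1 mulrDl mul1r sinD IH s0 mul0r mulr0 addr0.
rewrite -mulrA mulr_natl cos_mulr2n cos2sin2 H expr0n/= subr0.
lra.
Qed.

Lemma rfejer_tail N t (d : R) : 0 < d -> d <= `|sin (pi * t)| ->
  rfejer N t <= (N.+1%:R * d ^+ 2)^-1.
Proof.
move=> d0 ds; have N0 : 0 < N.+1%:R :> R by rewrite ltr0n.
rewrite -div1r ler_pdivlMr ?mulr_gt0 ?exprn_gt0//.
rewrite mulrCA mulrA.
apply: (@le_trans _ _ (N.+1%:R * rfejer N t * sin (pi * t) ^+ 2)).
  apply: ler_wpM2l; first by rewrite mulr_ge0 ?ler0n ?rfejer_ge0.
  by rewrite -[leRHS]real_normK ?num_real// lerXn2r// ?nnegrE// ltW.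
rewrite rfejer_sin -[leLHS]real_normK ?num_real// expr_le1//.
exact: sin_max.
Qed.

(** The mean value theorem gives [sin y >= y cos y]; it is applied to [y = x / 2] and combined
with the duplication formulas. *)
Lemma sin_ge_half x : 0 <= x <= pi / 2 -> x / 2 <= sin x.
Proof.
move=> /andP[x0 xpi].
move: x0; rewrite le_eqVlt => /predU1P[<-|x0]; first by rewrite sin0 mul0r.
have [c] : exists2 c, c \in `]0, (x / 2)[ & sin (x / 2) - sin 0 = cos c * (x / 2 - 0).
  apply: MVT; first by rewrite divr_gt0.
  by apply: continuous_subspaceT => y; exact: continuous_sin.
rewrite in_itv /= sin0 !subr0 => /andP[c0 cx] sE.
have cc : cos (x / 2) <= cos c.
  by have := pi_ge2 R => p2; rewrite ltW// ltr_cos ?in_itv/=; lra.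
have cx0 : 0 <= cos x by apply: cos_ge0_pihalf; have := pi_ge2 R; lra.
have xE : x = (x / 2) *+ 2 by rewrite mulr2n; field.
have chalf : 0 <= cos (x / 2) by apply: cos_ge0_pihalf; have := pi_ge2 R; lra.
rewrite [X in _ <= sin X]xE sin_mulr2n.
rewrite [X in cos X]xE cos_mulr2n in cx0.
rewrite sE; set k := cos (x / 2) in cc cx0 chalf *.
rewrite -mulr_natr in cx0.
have h : 1 <= k * cos c * 2 by nra.
have y0 : 0 <= x / 2 by lra.
by have := ler_wpM2l y0 h; rewrite mulr1 mulr2n; lra.
Qed.

Lemma sinpi_ge (d : R) : `|d| <= 1 / 2 -> `|d| <= `|sin (pi * d)|.
Proof.
have H (y : R) : 0 <= y <= 1 / 2 -> y <= `|sin (pi * y)|.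
  move=> /andP[y0 y1]; have p2 := pi_ge2 R.
  apply: le_trans (ler_norm _).
  have : pi * y / 2 <= sin (pi * y) by apply: sin_ge_half; apply/andP; split; nra.
  nra.
have [d0|d0] := leP 0 d => dh; first by rewrite ger0_norm// in dh *; apply: H; rewrite d0.
rewrite ltr0_norm// in dh *; rewrite -[X in sin (_ * X)]opprK mulrN sinN normrN.
by apply: H; lra.
Qed.


(** The index of the dyadic arc of length [2 ^- l] of the circle R/Z that contains [a], in the
standard grid when [s] is false and in the grid translated by -1/3 when [s] is true. *)
Definition dyadic_label (s : bool) (l : nat) (a : R) : nat :=
  `|(Num.floor (2 ^+ l * (a + s%:R / 3)) %% ((2 : int) ^+ l)%R)%Z|%N.

Lemma dyadic_label_eqP s l a b :
  reflect (exists q : int, Num.floor (2 ^+ l * (a + s%:R / 3)) =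
    Num.floor (2 ^+ l * (b + s%:R / 3)) + q * 2 ^+ l)
   (dyadic_label s l a == dyadic_label s l b).
Proof.
rewrite /dyadic_label; set A := Num.floor _; set B := Num.floor _.
have l0 : (2 ^+ l : int) != 0 by rewrite expf_neq0.
have -> : (`|(A %% ((2 : int) ^+ l)%R)%Z|%N == `|(B %% ((2 : int) ^+ l)%R)%Z|%N) =
    (2 ^+ l %| A - B)%Z.
  by rewrite -eqz_mod_dvd -eqz_nat !gez0_abs ?modz_ge0.
apply: (iffP dvdzP) => -[q]; first by move/eqP; rewrite subr_eq addrC => /eqP; exists q.
by move=> ->; exists q; rewrite addrC addKr.
Qed.

Lemma dyadic_label0 s a b : dyadic_label s 0 a == dyadic_label s 0 b.
Proof. apply/dyadic_label_eqP; rewrite !expr0.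
exists (Num.floor (1 * (a + s%:R / 3)) - Num.floor (1 * (b + s%:R / 3))); ring. Qed.

Lemma dyadic_label_nested s l a b :
  dyadic_label s l.+1 a = dyadic_label s l.+1 b -> dyadic_label s l a = dyadic_label s l b.
Proof.
move=> /eqP/dyadic_label_eqP[q]; rewrite !exprS -!(mulrA 2) => E.
apply/eqP/dyadic_label_eqP; exists q.
move: E; set za := _ ^+ l * (a + _); set zb := _ ^+ l * (b + _) => E.
have H (z : R) : exists2 r : int, r = 0 \/ r = 1 & Num.floor (2 * z) = 2 * Num.floor z + r.
  have := floor_itv z; have := floor_itv (2 * z) => /andP[h1 h2] /andP[h3 h4].
  have h5 : 2 * Num.floor z < Num.floor (2 * z) + 1.
    by rewrite -(ltr_int R) rmorphM/=; lra.
  have h6 : Num.floor (2 * z) < 2 * (Num.floor z + 1).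
    by rewrite -(ltr_int R) rmorphM/=; lra.
  exists (Num.floor (2 * z) - 2 * Num.floor z); last lia.
  lia.
have [ra Ha Ea] := H za; have [rb Hb Eb] := H zb.
rewrite Ea Eb in E; set p := 2 ^+ l in E *; lia.
Qed.

Lemma dyadic_label_nested_le s l l' a b : (l <= l')%N ->
  dyadic_label s l' a = dyadic_label s l' b -> dyadic_label s l a = dyadic_label s l b.
Proof.
elim: l' => [|l' IH]; first by rewrite leqn0 => /eqP->.
by rewrite leq_eqVlt => /predU1P[->//|/IH H /dyadic_label_nested].
Qed.

(** If two nearby points are separated by both grids, then a multiple of [2 ^- l] and
a multiple of [2 ^- l] shifted by 1/3 are at distance less than [2 ^- l / 3]; multiplying by
[3 * 2 ^+ l] shows that 3 divides [2 ^+ l]. *)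
Lemma one_third_trick l a b (e : int) : `|a - b - e%:~R| * 2 ^+ l < 1 / 3 ->
  exists s, dyadic_label s l a == dyadic_label s l b.
Proof.
move=> H; apply: contrapT => /forallNP nlab.
pose A s := 2 ^+ l * (a + (nat_of_bool s)%:R / 3).
pose B s := 2 ^+ l * (b + e%:~R + (nat_of_bool s)%:R / 3).
have l0 : 0 < 2 ^+ l :> R by rewrite exprn_gt0.
have fl s : Num.floor (A s) <> Num.floor (B s).
  move=> E; apply: (nlab s); apply/dyadic_label_eqP; exists e.
  rewrite -/(A s) E /B.
  have -> : 2 ^+ l * (b + e%:~R + s%:R / 3) = 2 ^+ l * (b + s%:R / 3) + (e * 2 ^+ l)%:~R.
    by rewrite rmorphM rmorphXn /=; ring.
  by rewrite floorDrz ?intr_int// intrKfloor.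
have sep (x y : R) : x < y -> Num.floor x <> Num.floor y ->
    exists2 k : int, x < k%:~R & k%:~R <= y.
  move=> xy fxy; exists (Num.floor y); last by have /andP[] := floor_itv y.
  rewrite real_ltNge ?num_real//; apply/negP => h; apply: fxy.
  apply/floor_def; rewrite h /= (lt_trans xy)//.
  by have /andP[] := floor_itv y.
have sep2 (x y w : R) : x < y -> y - x < 1 / 3 -> Num.floor x <> Num.floor y ->
   Num.floor (x + w) <> Num.floor (y + w) -> exists k : int, `|k%:~R - w| < 1 / 3.
  move=> xy xy3 /(sep _ _ xy)[k k1 k2] f2.
  have [k' k3 k4] := sep _ _ (ltr_leD xy (lexx w)) f2.
  by exists (k' - k); rewrite rmorphB/= ltr_norml; apply/andP; split; lra.
have A1 : A true = A false + 2 ^+ l / 3 by rewrite /A /=; field.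
have B1 : B true = B false + 2 ^+ l / 3 by rewrite /B /=; field.
have AB : `|A false - B false| < 1 / 3.
  have -> : A false - B false = (a - b - e%:~R) * 2 ^+ l by rewrite /A /B; ring.
  by rewrite normrM (gtr0_norm l0).
have [k kl] : exists k : int, `|k%:~R - 2 ^+ l / 3| < 1 / 3 :> R.
  have := fl true; rewrite A1 B1.
  have [ab|ab|ab] := ltgtP (A false) (B false).
  - by apply: sep2 => //; move: AB; rewrite ltr_norml; lra.
  - by move=> /nesym; apply: sep2 => //; [move: AB; rewrite ltr_norml; lra|exact/nesym].
  - by case: (fl false); rewrite ab.
have : `|3 * k - 2 ^+ l| < 1.
  rewrite -(ltr_int R) intr_norm rmorphB rmorphM rmorphXn /=.
  by move: kl; rewrite !ltr_norml; lra.
have : (3 %| 2 ^+ l)%Z = false.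
  by rewrite dvdzE abszX Euclid_dvdX//; case: l {H nlab A B l0 fl A1 B1 AB kl}.
rewrite ltr_norml => h1 /andP[h2 h3]; move/negP: h1; apply; apply/dvdzP; exists k.
lia.
Qed.

(** The exponent [i] measures the distance from [a - b] to the integers in units of [2 ^- m]. For
[i = 0] the trivial bound of the kernel by [2 N + 1] is enough, otherwise the decay of [rfejer_tail]
is used. For [i = m + 1] the arc is the whole circle, in accordance with [m - i = 0]. *)
Lemma rfejer_scale m N a b : (2 ^ m <= N.+1 < 2 ^ m.+1)%N ->
  exists i s, [/\ (i < m.+2)%N, dyadic_label s (m - i) a == dyadic_label s (m - i) b &
     rfejer N (a - b) <= 36 * 2 ^+ m / 4 ^+ i].
Proof.
move=> /andP[mN Nm].
have mNR : 2 ^+ m <= N.+1%:R :> R by rewrite -natrX ler_nat.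
have m0 : 0 < 2 ^+ m :> R by rewrite exprn_gt0.
pose e := Num.floor (a - b + 1 / 2); pose d := a - b - e%:~R.
have d2 : `|d| <= 1 / 2.
  have /andP[] := floor_itv (a - b + 1 / 2); rewrite -/e rmorphD /= => h1 h2.
  by rewrite ler_norml /d; lra.
have fE : rfejer N (a - b) = rfejer N d by rewrite -(rfejerDz N d e) subrK.
(* The exponent of the statement is the least [i] satisfying [P]. *)
pose P i := `|d| * 2 ^+ m < 2 ^+ i / 3.
have exP : exists i, P i.
  by exists m.+1; rewrite /P exprS; nra.
case: (ex_minnP exP) => -[|i] Pi mini.
  have [s Es] : exists s, dyadic_label s m a == dyadic_label s m b.
    by apply: (@one_third_trick _ _ _ e); move: Pi; rewrite /P expr0.
  exists 0%N, s; rewrite subn0 expr0 divr1; split => //.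
  apply: (le_trans (rfejer_le _ _)).
  have : (N.*2.+1 <= 36 * 2 ^ m)%N by move: Nm; rewrite expnS; lia.
  by rewrite -(ler_nat R) natrM natrX.
have im : (i.+1 <= m.+1)%N by apply: mini; rewrite /P exprS; nra.
have nPi : 2 ^+ i / 3 <= `|d| * 2 ^+ m.
  by rewrite leNgt; apply/negP => /mini; rewrite ltnn.
have [s Es] : exists s, dyadic_label s (m - i.+1) a == dyadic_label s (m - i.+1) b.
  have [im'|im'] := leqP i.+1 m.
    apply: (@one_third_trick _ _ _ e); rewrite -/d.
    have i0 : 0 < 2 ^+ i.+1 :> R by rewrite exprn_gt0.
    rewrite -(ltr_pM2r i0) -mulrA -exprD subnK//.
    by move: Pi; rewrite /P; lra.
  exists true; have -> : (m - i.+1 = 0)%N by lia.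
  exact: dyadic_label0.
exists i.+1, s; split => //.
have i0 : 0 < 2 ^+ i :> R by rewrite exprn_gt0.
have i4 : 4 ^+ i.+1 = 4 * (2 ^+ i) ^+ 2 :> R.
  by rewrite exprS -exprM mulnC exprM; congr (_ * _ ^+ _); ring.
have dd : 2 ^+ i / 3 / 2 ^+ m <= `|d| by rewrite ler_pdivrMr.
rewrite fE; apply: (le_trans (rfejer_tail N _ (le_trans dd (sinpi_ge d2)))).
  by rewrite !divr_gt0.
have -> : 36 * 2 ^+ m / 4 ^+ i.+1 = (2 ^+ m * (2 ^+ i / 3 / 2 ^+ m) ^+ 2)^-1 :> R.
  by rewrite i4; field; rewrite !gt_eqF.
rewrite lef_pV2 ?posrE ?mulr_gt0 ?exprn_gt0 ?divr_gt0 ?ltr0n//.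
by rewrite ler_wpM2r// sqr_ge0.
Qed.

(** Only the term of the sum provided by [rfejer_scale] is needed. The bound [M] is left free
so that the same index set can serve all [N] in a given range. *)
Lemma rfejer_dom m N M a b : (2 ^ m <= N.+1 < 2 ^ m.+1)%N -> (m.+2 <= M)%N ->
  rfejer N (a - b) <= \sum_(p : 'I_M * bool)
    36 * 2 ^+ m / 4 ^+ p.1 * (dyadic_label p.2 (m - p.1) a == dyadic_label p.2 (m - p.1) b)%:R.
Proof.
move=> mN mM; have [i [s [im Es h]]] := rfejer_scale a b mN.
apply: (le_trans h); rewrite (bigD1 (Ordinal (leq_trans im mM), s))//= Es mulr1.
rewrite lerDl sumr_ge0// => p _; rewrite mulr_ge0 ?divr_ge0 ?mulr_ge0 ?exprn_ge0//.
Qed.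

End fejer_one_variable.

(** * Measure of the dyadic arcs *)

Section dyadic_fibers.
Context {R : realType}.

Lemma measurable_floor_eq (c d : R) (q : int) : measurable [set b : measurableTypeR R | Num.floor (c * b + d) = q].
Proof.
have mf : measurable_fun [set: measurableTypeR R] (fun b : measurableTypeR R => c * b + d).
  by apply: measurable_funD => //; apply: measurable_funM.
rewrite (_ : mkset _ = setT `&` (fun b : measurableTypeR R => c * b + d) @^-1` `[q%:~R, (q + 1)%:~R[%classic).
  exact: mf.
rewrite setTI; apply/seteqP; split => b /=; rewrite in_itv /=; last exact: floor_def.
by move=> <-; exact: floor_itv.
Qed.

Lemma measurable_dyadic_label s l (t : R) k :
  measurable [set b : measurableTypeR R | dyadic_label s l (b / t) = k].
Proof.
pose c : R := 2 ^+ l / t; pose d : R := 2 ^+ l * (s%:R / 3).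
have E b : dyadic_label s l (b / t) = `|(Num.floor (c * b + d) %% ((2 : int) ^+ l)%R)%Z|%N.
  by rewrite /dyadic_label; congr (`|(Num.floor _ %% _)%Z|%N); rewrite /c /d; ring.
pose A (q : int) := if `|(q %% ((2 : int) ^+ l)%R)%Z|%N == k then
  [set b : measurableTypeR R | Num.floor (c * b + d) = q] else set0.
have mA q : measurable (A q) by rewrite /A; case: ifP => // _; exact: measurable_floor_eq.
rewrite (_ : mkset _ = \bigcup_j (A (Posz j) `|` A (Negz j))).
  by apply: bigcup_measurable => j _; exact: measurableU.
apply/seteqP; split => b /=; rewrite E.
  move=> bk; case Eq : (Num.floor (c * b + d)) => [j|j]; exists j => //; [left|right];
  by rewrite /A -Eq bk eqxx.
by move=> [j _ [|]]; rewrite /A; case: ifP => // /eqP + /= ->.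
Qed.

(** Over an interval of one period, a dyadic arc of the circle comes from at most three dyadic
intervals of the line; they are described relative to the point [x]. The factor 3 replaces the
exact computation, which would have to treat the end points. *)
Lemma dyadic_label_fiber_le s l (t x : R) : 0 < t -> - (t / 2) <= x <= t / 2 ->
  exists2 A : set (measurableTypeR R), measurable A /\ (lebesgue_measure A <= (3 * t / 2 ^+ l)%:E)%E &
   forall y, - (t / 2) <= y <= t / 2 -> dyadic_label s l (y / t) = dyadic_label s l (x / t) -> A y.
Proof.
move=> t0 xt; have l0 : 0 < 2 ^+ l :> R by rewrite exprn_gt0.
pose I (q : int) : set (measurableTypeR R) :=
  `[t * (q%:~R / 2 ^+ l - s%:R / 3), t * ((q + 1)%:~R / 2 ^+ l - s%:R / 3)[%classic.
have mI q : measurable (I q) by exact: measurable_itv.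
have lI q : lebesgue_measure (I q) = (t / 2 ^+ l)%:E.
  rewrite lebesgue_measure_itv /= lte_fin ltr_pM2l// ltrD2r ltr_pM2r ?invr_gt0// ltr_int ltrDl ltr01.
  by rewrite -EFinB rmorphD /=; congr EFin; ring.
have IP q y : Num.floor (2 ^+ l * (y / t + s%:R / 3)) = q -> I q y.
  move=> <-; rewrite /I /= in_itv /=.
  have /andP[] := floor_itv (2 ^+ l * (y / t + s%:R / 3)); set F := Num.floor _.
  rewrite -[X in _ <= X]mulrC -[X in X < _]mulrC -ler_pdivrMr// -ltr_pdivlMr// => h1 h2.
  have -> : y = t * (y / t) by rewrite mulrC divfK ?gt_eqF.
  by rewrite ler_pM2l// ltr_pM2l// lerBlDr ltrBrDr h1 h2.
pose q0 := Num.floor (2 ^+ l * (x / t + s%:R / 3)).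
exists (I q0 `|` I (q0 + 2 ^+ l) `|` I (q0 - 2 ^+ l)).
  split; first by do 2? apply: measurableU.
  apply: (@le_trans _ _ ((t / 2 ^+ l)%:E + (t / 2 ^+ l)%:E + (t / 2 ^+ l)%:E)%E); last first.
    by rewrite -!EFinD lee_fin; lra.
  rewrite -{1}(lI q0) -{1}(lI (q0 + 2 ^+ l)) -(lI (q0 - 2 ^+ l)).
  apply: le_trans (measureU2 _ _ _) _ => //; first exact: measurableU.
  by rewrite leeD2r// measureU2.
move=> y yt /eqP/dyadic_label_eqP[q]; rewrite -/q0; set F := Num.floor _ => Fq.
have h1 : `|y / t - x / t| <= 1.
  rewrite -mulrBl normrM (gtr0_norm (_ : 0 < t^-1)) ?invr_gt0//.
  by rewrite ler_pdivrMr// mul1r ler_norml; lra.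
have h3 : `|F - q0| < 2 ^+ l + 1.
  rewrite -(ltr_int R) intr_norm rmorphB rmorphD rmorphXn /=.
  have := floor_itv (2 ^+ l * (y / t + s%:R / 3)); have := floor_itv (2 ^+ l * (x / t + s%:R / 3)).
  rewrite -/F -/q0 !rmorphD /= => /andP[a1 a2] /andP[a3 a4].
  move: h1; rewrite ler_norml ltr_norml => /andP[b1 b2].
  apply/andP; split; nra.
have h4 : (2 ^+ l : int) > 0 by rewrite exprn_gt0.
have : q = 0 \/ q = 1 \/ q = -1.
  move: h3; rewrite Fq addrAC subrr add0r ltr_norml; set p := 2 ^+ l in h4 *.
  nia.
move=> [q0E|[q0E|q0E]]; rewrite q0E ?mul0r ?mul1r ?mulN1r ?addr0 in Fq.
- by left; left; exact: IP.
- by left; right; exact: IP.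
- by right; exact: IP.
Qed.

End dyadic_fibers.

(** * Domination and weak type bound in several variables *)

Section fejer_operator.
Context {R : realType} (n : nat) (alpha : R).
Hypothesis sin_neq0 : sin alpha != 0.

Local Notation s := (torus_side alpha).
Local Notation mu := (torus_measure alpha n).
Local Notation Q := (@torus_cube R alpha n).
Local Notation T := (RT R n).

Lemma torus_side_gt0 : 0 < s. Proof. by rewrite normr_gt0. Qed.
Local Notation s0 := torus_side_gt0.

Lemma torus_cubeP (x : T) i : Q x -> - (s / 2) <= tnth x i <= s / 2.
Proof. by move=> /(_ i); rewrite in_itv. Qed.

Lemma torus_measureE A : mu A = lebesgue_tuple n (A `&` Q).
Proof. by []. Qed.

Lemma torus_cube_fin : (lebesgue_tuple n Q < +oo)%E.
Proof.
rewrite (lebesgue_tuple_box (A := fun=> [set` `[- (s / 2), s / 2]]))//.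
rewrite (eq_bigr (fun=> s%:E)); first by rewrite prodEFin ltry.
move=> i _; rewrite lebesgue_measure_itv /= lte_fin ifT.
  by rewrite -EFinB; congr EFin; field.
by have := s0; lra.
Qed.

Lemma torus_measure_fin : (mu setT < +oo)%E.
Proof. by rewrite torus_measureE setTI torus_cube_fin. Qed.

(** The measure of the torus again, as an instance of the structure of finite measures that
Tonelli's theorem looks for. *)
Definition torus_fin_measure : {finite_measure set T -> \bar R} :=
  mfrestr (@measurable_torus_cube R alpha n) torus_cube_fin.

Definition fejer_kernel N (x y : T) : R := \prod_(i < n) rfejer N ((tnth x i - tnth y i) * csc alpha).

(** The sign of [sin alpha] disappears because the kernel is even. *)
Lemma rfejer_csc N t : rfejer N (t * csc alpha) = rfejer N (t / s).
Proof.
rewrite /csc /torus_side; have [_|_] := ger0P (sin alpha); first by [].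
by rewrite invrN mulrN rfejerN.
Qed.

Lemma fejer_kernel_ge0 N x y : 0 <= fejer_kernel N x y.
Proof. by apply: prodr_ge0 => i _; exact: rfejer_ge0. Qed.

Lemma measurable_rfejer N : measurable_fun [set: measurableTypeR R] (rfejer N).
Proof.
apply: measurable_sum => k; apply: measurable_funM => //.
apply: (measurableT_comp (f := cos)); first exact: (continuous_measurable_fun (@continuous_cos R)).
exact: measurable_funM.
Qed.

Lemma measurable_fejer_kernel N : measurable_fun [set: T * T] (fun z => fejer_kernel N z.1 z.2).
Proof.
apply: measurable_prod => i _; apply: (measurableT_comp (measurable_rfejer N)).
apply: measurable_funM => //; apply: measurable_funB.
  exact: (measurableT_comp (measurable_tnth i)).
exact: (measurableT_comp (measurable_tnth i)).
Qed.

Lemma measurable_fejer_kernelr N x : measurable_fun [set: T] (fejer_kernel N x).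
Proof. exact: (measurableT_comp (measurable_fejer_kernel N) (pair1_measurable x)). Qed.

(** Defined for nonnegative [u] with values in the extended reals, so that positive operators can
be manipulated without integrability conditions. *)
Definition fejer_integral N (u : T -> R) (x : T) : \bar R := (\int[mu]_y (u y * fejer_kernel N x y)%:E)%E.

Definition fejer_maximal (u : T -> R) (x : T) : \bar R :=
  ereal_sup [set ((s ^- n)%:E * fejer_integral N u x)%E | N in setT].

Lemma measurable_fejer_integral N (u : T -> R) : measurable_fun setT u -> (forall x, 0 <= u x) ->
  measurable_fun setT (fejer_integral N u).
Proof.
move=> meas_u u0.
apply: (@measurable_fun_fubini_tonelli_F _ _ _ _ _ torus_fin_measure (fun z => (u z.2 * fejer_kernel N z.1 z.2)%:E)).
  apply/measurable_EFinP; apply: measurable_funM; last exact: measurable_fejer_kernel.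
  exact: (measurableT_comp meas_u).
by move=> z; rewrite lee_fin mulr_ge0// fejer_kernel_ge0.
Qed.

Lemma fejer_integral_ge0 N (u : T -> R) x : (forall x, 0 <= u x) -> (0 <= fejer_integral N u x)%E.
Proof. by move=> u0; apply: integral_ge0 => y _; rewrite lee_fin mulr_ge0// fejer_kernel_ge0. Qed.

Section box_label.
Variables (M : nat) (k : {ffun 'I_n -> 'I_M * bool}).

(** The dyadic box of [x] at level [m]. Coordinate [i] uses the grid [(k i).2] and the side
[2 ^- (m - (k i).1)]: the truncated subtraction stops at the whole circle. The shape of the box
depends on [k] only, so that the boxes are nested as [m] grows. *)
Definition box_label m (x : T) : nat :=
  pickle [seq dyadic_label (k i).2 (m - (k i).1) (tnth x i / s) | i <- enum 'I_n].

Lemma box_labelP m x y : box_label m x = box_label m y <->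
  forall i, dyadic_label (k i).2 (m - (k i).1) (tnth x i / s) = dyadic_label (k i).2 (m - (k i).1) (tnth y i / s).
Proof.
split => [/(pcan_inj pickleK)/eq_in_map E i|E]; first by apply: E; rewrite mem_enum.
by congr pickle; apply: eq_map => i.
Qed.

Lemma box_label_nested m x y : box_label m.+1 x = box_label m.+1 y -> box_label m x = box_label m y.
Proof.
move=> /box_labelP E; apply/box_labelP => i; apply: dyadic_label_nested_le (E i).
by rewrite leq_sub2r.
Qed.

Lemma measurable_box_label m j : measurable (box_label m @^-1` [set j]).
Proof.
have [->|/set0P[x0 /= <-]] := eqVneq (box_label m @^-1` [set j]) set0; first exact: measurable0.
rewrite (_ : _ @^-1` _ = \bigcap_(i in [set: 'I_n]) ((fun x : T => tnth x i) @^-1`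
   [set b | dyadic_label (k i).2 (m - (k i).1) (b / s) = dyadic_label (k i).2 (m - (k i).1) (tnth x0 i / s)])).
  apply: fin_bigcap_measurable => // i _.
  rewrite -[X in measurable X]setTI; apply: measurable_tnth => //.
  exact: measurable_dyadic_label.
apply/seteqP; split => x /= => [/box_labelP E i _|E]; first exact: E.
by apply/box_labelP => i; exact: E.
Qed.

(** Each coordinate contributes the fiber bound of one variable. By this bound, an integral over the
atom that is large for the size of the box is also large for the measure of the atom. *)
Lemma measure_box_atom_le m x : Q x ->
  (mu (atom box_label m x) <= (\prod_(i < n) (3 * s / 2 ^+ (m - (k i).1)))%:E)%E.
Proof.
move=> Qx.
have H i : exists A : set (measurableTypeR R),
    [/\ measurable A, (lebesgue_measure A <= (3 * s / 2 ^+ (m - (k i).1))%:E)%E &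
   forall y, - (s / 2) <= y <= s / 2 ->
     dyadic_label (k i).2 (m - (k i).1) (y / s) = dyadic_label (k i).2 (m - (k i).1) (tnth x i / s) -> A y].
  have [A [mA lA] HA] := dyadic_label_fiber_le (k i).2 (m - (k i).1) s0 (torus_cubeP i Qx).
  by exists A.
have [A HA] := choice H.
have mA i : measurable (A i) by have [] := HA i.
rewrite torus_measureE.
apply: (@le_trans _ _ (lebesgue_tuple n [set y | forall i, A i (tnth y i)])).
  apply: le_measure; rewrite ?inE.
  - by apply: measurableI; [exact: measurable_box_label|exact: measurable_torus_cube].
  - rewrite (_ : mkset _ = \bigcap_(i in [set: 'I_n]) ((fun x : T => tnth x i) @^-1` A i)).
      apply: fin_bigcap_measurable => // i _.
      by rewrite -[X in measurable X]setTI; exact: measurable_tnth.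
    by apply/seteqP; split=> y //= h i; [move=> _; exact: h | exact: h].
  - move=> y [/= /box_labelP E Qy] i; have [_ _] := HA i; apply; last exact: E.
    exact: torus_cubeP.
rewrite lebesgue_tuple_box// -prodEFin.
apply: (proj2 (A := (0 <= \prod_(i < n) lebesgue_measure (A i))%E)).
elim/big_ind2 : _ => [|a b c d [a0 ab] [c0 cd]|i _]; first by rewrite lexx.
  by split; [exact: mule_ge0|exact: lee_pmul].
by have [_ ? _] := HA i.
Qed.

End box_label.

(** The factor by which the averages over the boxes of shape [k] may exceed the level [l]. Any
base strictly between 1 and 2 makes both sums converge: that of the products of [2 ^- i] with this
weight, and that of its inverse. *)
Definition box_weight M (k : {ffun 'I_n -> 'I_M * bool}) : R := \prod_(i < n) (3 / 2) ^+ (k i).1.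

Lemma box_weight_ge1 M (k : {ffun 'I_n -> 'I_M * bool}) : 1 <= box_weight k.
Proof. 
apply: (big_ind (fun z => 1 <= z)) => // [a b a1 b1|i _]; first by rewrite mulr_ege1.
by rewrite exprn_ege1//; lra.
Qed.

(** The product over the coordinates of the one-dimensional dominations, expanded by
distributivity. *)
Lemma fejer_kernel_dom m N M x y : (2 ^ m <= N.+1 < 2 ^ m.+1)%N -> (m.+2 <= M)%N ->
  fejer_kernel N x y <= \sum_(k : {ffun 'I_n -> 'I_M * bool})
    (\prod_(i < n) (36 * 2 ^+ m / 4 ^+ (k i).1)) * \1_(atom (box_label k) m x) y.
Proof.
move=> mN mM.
apply: (@le_trans _ _ (\prod_(i < n) \sum_(p : 'I_M * bool)
    36 * 2 ^+ m / 4 ^+ p.1 *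
     (dyadic_label p.2 (m - p.1) (tnth x i / s) == dyadic_label p.2 (m - p.1) (tnth y i / s))%:R)).
  apply: ler_prod => i _; rewrite rfejer_ge0 /= rfejer_csc mulrBl.
  exact: rfejer_dom.
rewrite bigA_distr_bigA /=; apply: ler_sum => k _.
rewrite big_split /= ler_wpM2l//.
  by apply: prodr_ge0 => i _; rewrite divr_ge0 ?mulr_ge0 ?exprn_ge0.
rewrite indicE; have [E|] := pselect (forall i,
    dyadic_label (k i).2 (m - (k i).1) (tnth x i / s) = dyadic_label (k i).2 (m - (k i).1) (tnth y i / s)).
  rewrite mem_set; last by apply/box_labelP => i; rewrite E.
  by rewrite big1// => i _; rewrite E eqxx.
move=> /existsNP[i /eqP/negbTE Ei].
by rewrite (bigD1 i)//= Ei mul0r ler0n.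
Qed.

Lemma geometric_sum_le (q : R) M : 0 <= q -> q < 1 -> \sum_(i < M) q ^+ i <= (1 - q)^-1.
Proof.
move=> q0 q1; have q10 : 0 < 1 - q by rewrite subr_gt0.
rewrite -div1r ler_pdivlMr// mulrC.
have := subrX1 q M; set S := \sum_(i < M) _ => E.
have := exprn_ge0 M q0; nra.
Qed.

Lemma integral_mul_indic (u : T -> R) A :
  (\int[mu]_y (u y * \1_A y)%:E = \int[mu]_(y in A) (u y)%:E)%E.
Proof.
rewrite [RHS]integral_mkcond; apply: eq_integral => y _; rewrite patchE indicE.
by case: ifP => _; rewrite ?mulr1 ?mulr0.
Qed.

(** If no average of [u] over the boxes of [x] is larger than its weight times [lam], then all
the means at [x] are controlled by [lam]. The constant is 864 = 36 * 3 * 2 * 4, from the bound of the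
kernel, the measure of the boxes, the number of grids and the sum of the series of [(3 / 4) ^+ i]. *)
Lemma fejer_integral_le M m N (u : T -> R) (x : T) (lam : R) : Q x -> measurable_fun setT u ->
  (forall y, 0 <= u y) -> (2 ^ m <= N.+1 < 2 ^ m.+1)%N -> (m.+2 <= M)%N -> 0 <= lam ->
  (forall k : {ffun 'I_n -> 'I_M * bool}, (\int[mu]_(y in atom (box_label k) m x) (u y)%:E <=
     (lam * box_weight k)%:E * mu (atom (box_label k) m x))%E) ->
  ((s ^- n)%:E * fejer_integral N u x <= (864 ^+ n * lam)%:E)%E.
Proof.
move=> Qx meas_u u0 mN mM lam0 H.
pose W (k : {ffun 'I_n -> 'I_M * bool}) : R := \prod_(i < n) (36 * 2 ^+ m / 4 ^+ (k i).1).
have W0 k : 0 <= W k.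
  by apply: prodr_ge0 => i _; rewrite divr_ge0 ?mulr_ge0 ?exprn_ge0.
have w0 M' (k : {ffun 'I_n -> 'I_M' * bool}) : 0 <= box_weight k.
  by rewrite (le_trans ler01)// box_weight_ge1.
have mI (k : {ffun 'I_n -> 'I_M * bool}) : measurable_fun setT (fun y => u y * \1_(atom (box_label k) m x) y).
  by apply: measurable_funM => //; apply: measurable_indic; exact: measurable_box_label.
have s0 := torus_side_gt0.
have step1 : (fejer_integral N u x <= \sum_(k : {ffun 'I_n -> 'I_M * bool})
    (W k)%:E * \int[mu]_(y in atom (box_label k) m x) (u y)%:E)%E.
  rewrite /fejer_integral.
  apply: (@le_trans _ _ (\int[mu]_y (\sum_(k : {ffun 'I_n -> 'I_M * bool})
    (W k)%:E * (u y * \1_(atom (box_label k) m x) y)%:E))%E).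
    apply: ge0_le_integral => //.
    - by move=> y _; rewrite lee_fin mulr_ge0// fejer_kernel_ge0.
    - by apply/measurable_EFinP; apply: measurable_funM => //; exact: measurable_fejer_kernelr.
    - by apply: emeasurable_sum => k; apply: measurable_funeM; exact/measurable_EFinP.
    - move=> y _; under eq_bigr do rewrite -EFinM mulrCA.
      by rewrite sumEFin lee_fin -mulr_sumr ler_wpM2l// fejer_kernel_dom.
  rewrite ge0_integral_sum//.
  - apply: lee_sum => k _; rewrite ge0_integralZl_EFin ?W0//.
    + by rewrite integral_mul_indic.
    + by move=> y _; rewrite lee_fin mulr_ge0.
    + exact/measurable_EFinP.
  - by move=> k; apply: measurable_funeM; exact/measurable_EFinP.
  - by move=> k y _; rewrite -EFinM lee_fin !mulr_ge0.
have step2 : (fejer_integral N u x <= \sum_(k : {ffun 'I_n -> 'I_M * bool})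
    (lam * \prod_(i < n) (108 * s * (3 / 4) ^+ (k i).1))%:E)%E.
  apply: (le_trans step1); apply: lee_sum => k _.
  apply: (@le_trans _ _ ((W k)%:E * ((lam * box_weight k)%:E * (\prod_(i < n) (3 * s / 2 ^+ (m - (k i).1)))%:E))%E).
    apply: lee_wpmul2l; first by rewrite lee_fin.
    apply: le_trans (H k) _; apply: lee_wpmul2l; last exact: measure_box_atom_le.
    by rewrite lee_fin mulr_ge0.
  rewrite -!EFinM lee_fin mulrCA -!mulrA ler_wpM2l// mulrCA mulrA.
  rewrite /W /box_weight -!big_split /=; apply: ler_prod => i _.
  apply/andP; split.
    by rewrite !mulr_ge0// ?invr_ge0 ?exprn_ge0// ?(ltW s0)//.
  set j := nat_of_ord (k i).1.
  have p2 (l : nat) : 0 < 2 ^+ l :> R by rewrite exprn_gt0.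
  have h : 2 ^+ m <= 2 ^+ j * 2 ^+ (m - j) :> R.
    by rewrite -exprD ler_weXn2l ?ler1n// -leq_subLR.
  have h34 : (3 / 4) ^+ j = (3 / 2) ^+ j * 2 ^+ j / 4 ^+ j :> R.
    by rewrite -exprMn -expr_div_n; congr (_ ^+ _); field.
  rewrite h34.
  have -> : 36 * 2 ^+ m / 4 ^+ j * (3 / 2) ^+ j * (3 * s / 2 ^+ (m - j)) =
    108 * s * ((3 / 2) ^+ j * (2 ^+ m / 2 ^+ (m - j)) / 4 ^+ j).
    by field; rewrite !gt_eqF// exprn_gt0.
  rewrite ler_wpM2l ?mulr_ge0 ?(ltW s0)// ler_wpM2r ?invr_ge0 ?exprn_ge0//.
  by rewrite ler_wpM2l ?exprn_ge0// ler_pdivrMr.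
apply: (@le_trans _ _ ((s ^- n)%:E * (lam * (864 * s) ^+ n)%:E)%E).
  apply: lee_wpmul2l; first by rewrite lee_fin invr_ge0 exprn_ge0// ltW.
  apply: (le_trans step2); rewrite sumEFin lee_fin -mulr_sumr ler_wpM2l//.
  rewrite -(bigA_distr_bigA (fun i (p : 'I_M * bool) => 108 * s * (3 / 4) ^+ p.1)) /=.
  rewrite -[X in _ <= _ ^+ X]card_ord -prodr_const; apply: ler_prod => i _.
  apply/andP; split.
    by apply: sumr_ge0 => p _; rewrite !mulr_ge0// ?exprn_ge0// ltW.
  rewrite -mulr_sumr -(pair_bigA _ (fun (i : 'I_M) (b : bool) => (3 / 4) ^+ i)) /=.
  rewrite (eq_bigr (fun i : 'I_M => 2 * (3 / 4) ^+ i)); last first.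
    by move=> j _; rewrite big_bool /=; ring.
  rewrite -mulr_sumr.
  have S4 : \sum_(i < M) (3 / 4) ^+ i <= 4 :> R.
    have e : (1 - 3 / 4)^-1 = 4 :> R by field.
    by apply: le_trans (geometric_sum_le _ _ _) _; rewrite ?e; lra.
  by nra.
rewrite -EFinM lee_fin exprMn mulrCA (mulrC (864 ^+ n)) mulKf ?(mulrC lam)//.
by rewrite expf_neq0// gt_eqF.
Qed.

Lemma trunc_log2P N : (2 ^ trunc_log 2 N.+1 <= N.+1 < 2 ^ (trunc_log 2 N.+1).+1)%N.
Proof. exact: trunc_log_bounds. Qed.

(** All averages of [u] are at most [B], and all weights are at least 1. *)
Lemma fejer_maximal_le (u : T -> R) (B : R) x : Q x -> measurable_fun setT u -> (forall y, 0 <= u y) ->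
  0 <= B -> {ae mu, forall y, u y <= B} -> (fejer_maximal u x <= (864 ^+ n * B)%:E)%E.
Proof.
move=> Qx meas_u u0 B0 uB; apply: ge_ereal_sup => _ [N _ <-].
apply: (fejer_integral_le Qx meas_u u0 (trunc_log2P N) (leqnn _) B0) => k.
have mA := measurable_box_label k (trunc_log 2 N.+1) (box_label k (trunc_log 2 N.+1) x).
apply: (@le_trans _ _ (\int[mu]_(y in atom (box_label k) (trunc_log 2 N.+1) x) B%:E)%E).
  apply: ae_ge0_le_integral => //.
  - by move=> y _; rewrite lee_fin.
  - by apply: measurable_funTS; exact/measurable_EFinP.
  - by apply: filterS uB => y yB _; rewrite lee_fin.
rewrite integral_cst//; apply: lee_wpmul2r => //.
by rewrite lee_fin ler_peMr// box_weight_ge1.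
Qed.

Lemma measure_bigsetU_le (I : Type) (r : seq I) (A : I -> set T) :
  (forall i, measurable (A i)) ->
  (mu (\big[setU/set0]_(i <- r) A i) <= \sum_(i <- r) mu (A i))%E.
Proof.
move=> mA; elim: r => [|i r IH]; first by rewrite !big_nil measure0.
rewrite !big_cons; apply: le_trans (measureU2 _ _ _) _ => //.
  by apply: bigsetU_measurable => j _.
by rewrite leeD2l.
Qed.

Section weak_type.
Variables (u : T -> R) (l : R).
Hypotheses (meas_u : measurable_fun setT u) (u0 : forall y, 0 <= u y) (l0 : 0 < l).

Let V : \bar R := (\int[mu]_y (u y)%:E)%E.

Let bad M (k : {ffun 'I_n -> 'I_M * bool}) : set T :=
  [set x | exists m, large_atom mu (box_label k) (EFin \o u) (l * box_weight k) m x].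

Let box_weight_gt0 M (k : {ffun 'I_n -> 'I_M * bool}) : 0 < box_weight k.
Proof. by rewrite (lt_le_trans ltr01)// box_weight_ge1. Qed.

Let mbad M (k : {ffun 'I_n -> 'I_M * bool}) : measurable (bad k).
Proof.
apply: measurable_large_atom; [exact: measurable_box_label|exact: box_label_nested].
Qed.

Let bad_le M (k : {ffun 'I_n -> 'I_M * bool}) :
  (mu (bad k) <= (l^-1 * (box_weight k)^-1)%:E * V)%E.
Proof.
rewrite -invfM lee_pdivlMl ?mulr_gt0//.
apply: doob_weak.
- exact: measurable_box_label.
- exact: box_label_nested.
- exact/measurable_EFinP.
- by move=> x; rewrite lee_fin.
- by rewrite mulr_ge0 ?ltW.
Qed.

Let sum_weight M : \sum_(k : {ffun 'I_n -> 'I_M * bool}) (box_weight k)^-1 <= 6 ^+ n.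
Proof.
rewrite (eq_bigr (fun k : {ffun 'I_n -> 'I_M * bool} => \prod_(i < n) (2 / 3) ^+ (k i).1)); last first.
  move=> k _; rewrite /box_weight -prodfV; apply: eq_bigr => i _.
  by rewrite -exprVn; congr (_ ^+ _); field.
rewrite -(bigA_distr_bigA (fun i (p : 'I_M * bool) => (2 / 3) ^+ p.1)) /=.
rewrite -[X in _ <= _ ^+ X]card_ord -prodr_const; apply: ler_prod => i _.
apply/andP; split; first by apply: sumr_ge0 => p _; rewrite exprn_ge0.
rewrite -(pair_bigA _ (fun (i : 'I_M) (b : bool) => (2 / 3) ^+ i)) /=.
rewrite (eq_bigr (fun i : 'I_M => 2 * (2 / 3) ^+ i)); last first.
  by move=> j _; rewrite big_bool /=; ring.
rewrite -mulr_sumr.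
have S3 : \sum_(i < M) (2 / 3) ^+ i <= 3 :> R.
  have e : (1 - 2 / 3)^-1 = 3 :> R by field.
    by apply: le_trans (geometric_sum_le _ _ _) _; rewrite ?e; lra.
by nra.
Qed.

Let big K : set T :=
  [set x | exists2 N, (N <= K)%N & ((864 ^+ n * l)%:E < (s ^- n)%:E * fejer_integral N u x)%E].

Let mbig K : measurable (big K).
Proof.
rewrite (_ : big K = \bigcup_(N in [set N | (N <= K)%N])
    [set x | ((864 ^+ n * l)%:E < (s ^- n)%:E * fejer_integral N u x)%E]).
  apply: bigcup_measurable => N _; rewrite -[X in measurable X]setTI.
  apply: emeasurable_fun_o_infty => //; apply: measurable_funeM.
  exact: measurable_fejer_integral.
by apply/seteqP; split => x [N NK h]; exists N.
Qed.

Let big_le K : (mu (big K) <= (l^-1)%:E * ((6 ^+ n)%:E * V))%E.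
Proof.
(* With this bound, [rfejer_dom] applies to all [N <= K] with the same shapes of boxes. *)
pose M := (trunc_log 2 K.+1).+2.
have sub : big K `&` Q `<=` \big[setU/set0]_(k : {ffun 'I_n -> 'I_M * bool}) bad k.
  move=> x [[N NK h] Qx]; apply: contrapT => nb.
  move: h; apply/negP; rewrite -leNgt.
  apply: (fejer_integral_le (M := M) Qx meas_u u0 (trunc_log2P N)); last 2 first.
  - exact: ltW.
  - move=> k; rewrite leNgt; apply/negP => h; apply: nb.
    by rewrite -bigcup_seq; exists k; [rewrite /= mem_index_enum|exists (trunc_log 2 N.+1)].
  - by rewrite !ltnS leq_trunc_log.
have mU : measurable (\big[setU/set0]_(k : {ffun 'I_n -> 'I_M * bool}) bad k).
  by apply: bigsetU_measurable => k _.
have -> : mu (big K) = mu (big K `&` Q) by rewrite !torus_measureE -setIA setIid.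
apply: (@le_trans _ _ (mu (\big[setU/set0]_(k : {ffun 'I_n -> 'I_M * bool}) bad k))).
  by apply: le_measure => //; rewrite inE//; apply: measurableI => //; exact: measurable_torus_cube.
apply: le_trans (measure_bigsetU_le _ _) _ => //.
apply: (@le_trans _ _ (\sum_(k : {ffun 'I_n -> 'I_M * bool}) (l^-1 * (box_weight k)^-1)%:E * V)%E).
  by apply: lee_sum => k _; exact: bad_le.
have V0 : (0 <= V)%E by apply: integral_ge0 => y _; rewrite lee_fin.
rewrite -ge0_sume_distrl; last first.
  by move=> k _; rewrite lee_fin mulr_ge0// invr_ge0 ltW.
rewrite muleA -EFinM; apply: lee_wpmul2r => //.
rewrite sumEFin lee_fin -mulr_sumr ler_wpM2l// ?invr_ge0 ?(ltW l0)//.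
Qed.

Lemma measurable_fejer_maximal : measurable_fun setT (fejer_maximal u).
Proof.
rewrite (_ : fejer_maximal u = fun x => ereal_sup [set (s ^- n)%:E * fejer_integral N u x | N in [set N | (0 <= N)%N]]%E).
  apply: (@measurable_fun_esups _ _ _ setT (fun N x => (s ^- n)%:E * fejer_integral N u x)%E _ 0%N).
  by move=> N; apply: measurable_funeM; exact: measurable_fejer_integral.
by apply/funext => x; congr ereal_sup; apply/seteqP; split => _ [N _ <-]; exists N.
Qed.

(** A point where the maximal function is large has a large average over one of its boxes, hence
lies in one of the exceptional sets of Doob's inequality. For [N <= K] finitely many shapes of boxes
are enough, with a bound independent of [K]; then [K] tends to infinity. The constant is
6 = 2 * 3, from the number of grids and the sum of the series of [(2 / 3) ^+ i]. *)
Lemma weak_type :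
  (l%:E * mu [set x | ((864 ^+ n * l)%:E < fejer_maximal u x)%E] <= (6 ^+ n)%:E * V)%E.
Proof.
rewrite -lee_pdivlMl//.
have -> : [set x | ((864 ^+ n * l)%:E < fejer_maximal u x)%E] = \bigcup_K big K.
  apply/seteqP; split => x /=.
    by move=> /ereal_sup_gt[_ [N _ <-] h]; exists N => //; exists N.
  by move=> [K _ [N _ h]]; apply: lt_le_trans h _; apply: ereal_sup_ubound; exists N.
have mUb : measurable (\bigcup_K big K) by exact: bigcup_measurable.
have ndb : nondecreasing_seq big.
  by move=> i j ij; apply/subsetPset => x [N Ni h]; exists N => //; exact: leq_trans ij.
have cv : mu \o big @ \oo --> mu (\bigcup_K big K) by exact: nondecreasing_cvg_mu.
rewrite -(cvg_lim _ cv)//; apply: lime_le; first by apply/cvg_ex; exists (mu (\bigcup_K big K)).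
by near=> K; exact: big_le.
Unshelve. all: by end_near. Qed.

End weak_type.

End fejer_operator.

(** * Mass and localization of the one-dimensional kernel *)

Section fejer_mass.
Context {R : realType}.
Implicit Types (x y t : R).

Lemma continuous_rfejer N : continuous (@rfejer R N).
Proof.
have cont (c : R) : continuous (fun t => cos (c * t)).
  move=> t; apply: (@continuous_comp _ _ _ (fun t => c * t) (@cos R)).
    exact: mulrl_continuous.
  exact: continuous_cos.
move=> t; apply: (@cvg_big _ _ +%R 0) => //=; first by move=> z; exact: add_continuous.
by move=> k _; apply: cvgMl_tmp; exact: cont.
Qed.

(** A primitive in [y] of the cosine of frequency [j]. *)
Definition fejer_prim (t x : R) (j : int) (y : R) : R :=
  if j == 0 then y else - (t / (2 * pi * j%:~R)) * sin (2 * pi * j%:~R / t * x - 2 * pi * j%:~R / t * y).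

Let is_derive_prim (t x : R) (j : int) (y : R) : 0 < t ->
  is_derive y 1 (fejer_prim t x j) (cos (2 * pi * j%:~R * ((x - y) / t))).
Proof.
move=> t0; have [->|j0] := eqVneq j 0.
  rewrite mulr0 mul0r cos0.
  by rewrite (_ : fejer_prim t x 0 = id)//; exact: is_derive_id.
set c : R := 2 * pi * j%:~R.
have -> : fejer_prim t x j = - (t / c) \*: (@sin R \o (fun y => c / t * x - c / t * y)).
  by apply/funext => z; rewrite /fejer_prim (negbTE j0).
have c0 : c != 0 by rewrite !mulf_neq0// ?intr_eq0// gt_eqF// pi_gt0.
have -> : c * ((x - y) / t) = c / t * x - c / t * y by field; rewrite gt_eqF.
have h1 : is_derive y 1 (fun y : R => c / t * x - c / t * y) (- (c / t)).
  have h2 : is_derive y 1 ((c / t) \*: (@idfun R)) (c / t *: 1) by apply: is_deriveZ.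
  have h3 := is_deriveB (is_derive_cst (c / t * x) y 1) h2.
  by apply: (is_derive_eq h3); rewrite sub0r; congr (- _); exact: mulr1.
have h4 := @is_derive1_comp _ (@sin R) (fun y => c / t * x - c / t * y) _ _ _ (is_derive_sin (c / t * x - c / t * y)) h1.
have h5 := is_deriveZ (- (t / c)) h4.
apply: (is_derive_eq h5).
rewrite /GRing.scale /=; field.
by rewrite c0 gt_eqF.
Qed.

(** By termwise integration over a period, only the constant term contributes. *)
Lemma fejer_mass N t x : 0 < t ->
  (\int[lebesgue_measure]_(y in `[(- (t / 2))%R, (t / 2)%R]) (rfejer N ((x - y) / t))%:E = t%:E)%E.
Proof.
move=> t0.
pose w (k : 'I_N.*2.+1) : R := 1 - `|k%:Z - N%:Z|%:~R / N.+1%:R.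
pose F : R -> R := \sum_(k < N.*2.+1) (w k \*: fejer_prim t x (k%:Z - N%:Z)).
have FE y : F y = \sum_(k < N.*2.+1) w k * fejer_prim t x (k%:Z - N%:Z) y.
  by rewrite /F fct_sumE.
have dF y : is_derive y 1 F (rfejer N ((x - y) / t)).
  by apply: is_derive_sum => k; apply: is_deriveZ; exact: is_derive_prim.
have cF : continuous F.
  by move=> y; apply: differentiable_continuous; apply/derivable1_diffP; have [] := dF y.
rewrite (@continuous_FTC2 _ _ F); first last.
- by move=> y _; rewrite derive1E; apply: derive_val.
- split.
  + by move=> y _; have [] := dF y.
  + by apply: cvg_at_right_filter; exact: cF.
  + by apply: cvg_at_left_filter; exact: cF.
- apply: continuous_subspaceT => y.
  apply: (@continuous_comp _ _ _ (fun y => (x - y) / t) (rfejer N)); last exact: continuous_rfejer.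
  apply: cvgMr_tmp; apply: cvgB; [exact: cvg_cst|exact: cvg_id].
- lra.
rewrite -EFinB !FE -sumrB; congr EFin.
have kN : (N < N.*2.+1)%N by lia.
rewrite (bigD1 (Ordinal kN))//= big1 ?addr0.
  by rewrite /w /fejer_prim subrr eqxx normr0 mul0r subr0 !mul1r; field.
move=> k kneq; rewrite -mulrBr /fejer_prim.
have /negbTE -> : k%:Z - N%:Z != 0.
  by move: kneq; apply: contra => /eqP h; apply/eqP/val_inj => /=; lia.
set c : R := 2 * pi * (k%:Z - N%:Z)%:~R.
have -> : c / t * x - c / t * (- (t / 2)) = (c / t * x - c / t * (t / 2)) + c.
  by field; rewrite gt_eqF.
by rewrite sinDz subrr mulr0.
Qed.

End fejer_mass.

Section fejer_localization.
Context {R : realType}.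
Variables (t x : R).
Hypotheses (t0 : 0 < t) (xt : - (t / 2) < x < t / 2).

Local Notation I := (`[(- (t / 2))%R, (t / 2)%R]%classic : set (measurableTypeR R)).

Definition fejer_part N (A : set (measurableTypeR R)) : \bar R :=
  (\int[lebesgue_measure]_(y in I `&` A) (rfejer N ((x - y) / t))%:E)%E.

Let mK N : measurable_fun [set: measurableTypeR R] (fun y : measurableTypeR R => (rfejer N ((x - y) / t))%:E).
Proof.
apply/measurable_EFinP; apply: (measurableT_comp (continuous_measurable_fun (@continuous_rfejer R N))).
by apply: measurable_funM => //; apply: measurable_funB.
Qed.

Let mI : measurable I. Proof. exact: measurable_itv. Qed.

Let lI : lebesgue_measure I = t%:E.
Proof.
have h : - (t / 2) < t / 2 by have := t0; lra.
have := lebesgue_measure_itv `[(- (t / 2))%R, (t / 2)%R]; rewrite /= lte_fin h.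
by rewrite -EFinB => ->; congr EFin; field.
Qed.

Lemma fejer_part_ge0 N A : (0 <= fejer_part N A)%E.
Proof. by apply: integral_ge0 => y _; rewrite lee_fin rfejer_ge0. Qed.

Lemma fejer_part_split N A : measurable A -> (fejer_part N A + fejer_part N (~` A) = t%:E)%E.
Proof.
move=> mA; rewrite -(fejer_mass N x t0) /fejer_part -ge0_integral_setU.
- by rewrite -setIUr setUv setIT.
- exact: measurableI.
- by apply: measurableI => //; exact: measurableC.
- exact: measurable_funTS.
- by move=> y _; rewrite lee_fin rfejer_ge0.
- by apply/disj_setPS => y [[_ ?] [_ ?]].
Qed.

Lemma fejer_part_fin N A : measurable A -> fejer_part N A \is a fin_num.
Proof.
move=> mA; rewrite ge0_fin_numE ?fejer_part_ge0//.
apply: (@le_lt_trans _ _ t%:E); last exact: ltry.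
by rewrite -(fejer_part_split N mA) leeDl// fejer_part_ge0.
Qed.

(** As [x] is interior to the period, the points of [A] stay at a positive distance from [x]
modulo the period, not only on the line; the closed form of the kernel is then uniformly [O(1 / N)]. *)
Lemma fejer_part_far (A : set (measurableTypeR R)) (e : R) : 0 < e -> measurable A -> (forall y, A y -> e <= `|x - y|) ->
  exists2 C : R, 0 <= C & forall N, (fejer_part N A <= (C / N.+1%:R)%:E)%E.
Proof.
move=> e0 mA Ae.
(* [d] bounds from below the distance from [(x - y) / t] to the integers: [e / t] for the integer 0,
   and the distance from [x] to the end points of the period for the integers 1 and -1. *)
pose d := Num.min (e / t) (1 / 2 - `|x| / t).
have xt2 : `|x| < t / 2 by rewrite ltr_norml.
have d0 : 0 < d.
  by rewrite lt_min divr_gt0//= subr_gt0 ltr_pdivrMr//; lra.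
exists (t / d ^+ 2); first by rewrite divr_ge0 ?exprn_ge0 ?ltW.
move=> N.
apply: (@le_trans _ _ (\int[lebesgue_measure]_(y in I `&` A) ((N.+1%:R * d ^+ 2)^-1)%:E)%E).
  apply: ge0_le_integral => //.
  - exact: measurableI.
  - by move=> y _; rewrite lee_fin rfejer_ge0.
  - exact: measurable_funTS.
  - move=> y [Iy Ay]; rewrite lee_fin.
    move: Iy; rewrite /= in_itv /= => yt.
    have [v h1 h2] : exists2 v, `|v| <= 1 / 2 /\ d <= `|v| & rfejer N ((x - y) / t) = rfejer N v.
      have ez : e / t <= `|(x - y) / t|.
        by rewrite normrM (gtr0_norm (_ : 0 < t^-1)) ?invr_gt0// ler_pM2r ?invr_gt0// Ae.
      have zb : `|(x - y) / t| <= 1 / 2 + `|x| / t.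
        rewrite normrM (gtr0_norm (_ : 0 < t^-1)) ?invr_gt0// ler_pdivrMr// mulrDl divfK ?gt_eqF//.
        rewrite (le_trans (ler_normB _ _))// addrC lerD2r.
        by rewrite ler_norml; lra.
      move: ez zb; set z := (x - y) / t => ez zb.
      have dm1 : d <= e / t by rewrite ge_min lexx.
      have dm2 : d <= 1 / 2 - `|x| / t by rewrite ge_min lexx orbT.
      have xt3 : `|x| / t <= 1 / 2 by lra.
      have [z2|z2] := leP `|z| (1 / 2).
        by exists z => //; split => //; exact: le_trans ez.
      have [z0|z0] := leP 0 z.
        exists (z - 1); last by rewrite -[RHS](rfejerDz N _ 1) subrK.
        rewrite ger0_norm// in zb z2; rewrite ler0_norm; last lra.
        by split; lra.
      exists (z + 1); last by rewrite -(rfejerDz N z 1).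
      rewrite ltr0_norm// in zb z2; rewrite ger0_norm; last lra.
      by split; lra.
    have [v2 dv] := h1.
    rewrite h2; apply: rfejer_tail => //.
    by apply: le_trans dv _; exact: sinpi_ge.
apply: (@le_trans _ _ (\int[lebesgue_measure]_(y in I) ((N.+1%:R * d ^+ 2)^-1)%:E)%E).
  apply: ge0_subset_integral => //; first exact: measurableI.
  by move=> y _; rewrite lee_fin invr_ge0 mulr_ge0 ?ler0n ?sqr_ge0.
rewrite (_ : integral _ _ _ = ((N.+1%:R * d ^+ 2)^-1%:E * t%:E)%E); last first.
  by rewrite -lI; exact: (integral_cst lebesgue_measure mI).
rewrite -EFinM lee_fin.
have N0 : N.+1%:R != 0 :> R by rewrite pnatr_eq0.
have -> // : t / d ^+ 2 / N.+1%:R = (N.+1%:R * d ^+ 2)^-1 * t by field; rewrite addrC natr1 N0 gt_eqF.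
Qed.

Let cvg_invn (C : R) : (fun N => C / N.+1%:R) @ \oo --> 0.
Proof. rewrite -(mulr0 C); apply: cvgMl_tmp; exact: cvg_harmonic. Qed.

(** The hypothesis says that [x] is not on the boundary of [A]. If [x] is outside, the mass tends
to 0; if it is inside, this applies to the complement because the total mass is 1. *)
Lemma fejer_part_cvg (A : set (measurableTypeR R)) (b : bool) (e : R) : 0 < e -> measurable A ->
  (forall y, `|x - y| < e -> (y \in A) = b) ->
  (fun N => fine (fejer_part N A) / t) @ \oo --> (b%:R : R).
Proof.
move=> e0 mA Ab.
have far (B : set (measurableTypeR R)) : measurable B -> (forall y, B y -> e <= `|x - y|) ->
    (fun N => fine (fejer_part N B) / t) @ \oo --> (0 : R).
  move=> mB Be; have [C C0 HC] := fejer_part_far e0 mB Be.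
  apply: (@squeeze_cvgr nat \oo _ R (fun=> 0) (fun N => C / t / N.+1%:R) (fun N => fine (fejer_part N B) / t)).
  - near=> N; rewrite divr_ge0 ?fine_ge0 ?fejer_part_ge0 ?(ltW t0)//=.
    rewrite mulrAC ler_pM2r ?invr_gt0//.
    by rewrite -lee_fin fineK ?fejer_part_fin.
  - exact: cvg_cst.
  - exact: cvg_invn.
case: b Ab => Ab; last first.
  apply: far => // y Ay; rewrite leNgt; apply/negP => /Ab.
  by rewrite mem_set.
have E : (fun N => fine (fejer_part N A) / t) = (fun N => 1 - fine (fejer_part N (~` A)) / t).
  apply/funext => N.
  have := congr1 fine (fejer_part_split N mA).
  rewrite fineD ?fejer_part_fin//=; last exact: measurableC.
  move=> H; have -> : fine (fejer_part N A) = t - fine (fejer_part N (~` A)).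
    by rewrite -[X in X - _]H addrK.
  by rewrite mulrBl divff ?gt_eqF.
rewrite E -[X in _ --> X]subr0; apply: cvgB; first exact: cvg_cst.
apply: far; first exact: measurableC.
move=> y nAy; rewrite leNgt; apply/negP => /Ab /set_mem; exact: nAy.
Unshelve. all: by end_near. Qed.

End fejer_localization.

(** * Products of functions of one variable, and boxes *)

Section tonelli_product.
Context {R : realType}.

(** Tonelli's theorem, one coordinate at a time. *)
Lemma integral_lebesgue_tuple_prod n (h : 'I_n -> measurableTypeR R -> R) :
  (forall i, measurable_fun setT (h i)) -> (forall i y, 0 <= h i y) ->
  (\int[lebesgue_tuple n]_y (\prod_(i < n) h i (tnth y i))%:E =
   \prod_(i < n) \int[lebesgue_measure]_y (h i y)%:E)%E.
Proof.
elim: n h => [|n IH] h mh h0.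
  rewrite big_ord0 /= integral_dirac//.
    by rewrite diracT mul1e big_ord0.
  by rewrite (_ : (fun _ => _) = cst 1%E)//; apply/funext => x; rewrite big_ord0.
rewrite -[LHS]/(integral (pushforward (lebesgue_measure \x lebesgue_tuple n)%E (@consRT R n)) setT _).
have mprod k (g : 'I_k -> measurableTypeR R -> R) : (forall i, measurable_fun setT (g i)) ->
    measurable_fun setT (fun y : RT R k => \prod_(i < k) g i (tnth y i)).
  move=> mg; apply: measurable_prod => i _.
  exact: (measurableT_comp (mg i) (measurable_tnth i)).
rewrite ge0_integral_pushforward//; last 3 first.
- exact: measurable_consRT.
- by apply/measurable_EFinP; exact: mprod.
- by move=> y _; rewrite lee_fin prodr_ge0.
rewrite preimage_setT.
pose f (z : measurableTypeR R * RT R n) : \bar R :=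
  ((h ord0 z.1)%:E * (\prod_(i < n) h (lift ord0 i) (tnth z.2 i))%:E)%E.
rewrite (eq_integral f); last first.
  move=> z _; rewrite /= big_ord_recl tnth0 EFinM; congr (_ * _%:E)%E.
  by apply: eq_bigr => i _; rewrite tnthS.
have mP := mprod _ _ (fun i => mh (lift ord0 i)).
have mf : measurable_fun setT f.
  apply: emeasurable_funM; apply/measurable_EFinP.
    exact: (measurableT_comp (mh ord0) measurable_fst).
  exact: (measurableT_comp mP measurable_snd).
rewrite fubini_tonelli1//; last first.
  by move=> z; rewrite /f -EFinM lee_fin mulr_ge0// prodr_ge0.
rewrite big_ord_recl /fubini_F /f /=.
under eq_integral => x _.
  rewrite ge0_integralZl_EFin//; last 2 first.
  - by move=> y _; rewrite lee_fin prodr_ge0.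
  - exact/measurable_EFinP.
  rewrite (IH (fun i => h (lift ord0 i)))//.
  over.
rewrite ge0_integralZr//.
- exact/measurable_EFinP.
- by move=> x _; rewrite lee_fin.
- by apply: prode_ge0 => i _; apply: integral_ge0 => y _; rewrite lee_fin.
Qed.

End tonelli_product.

Section boxes.
Context {R : realType} (n : nat).
Local Notation T := (RT R n).

Definition ray_box (a : 'I_n -> \bar R) : set T := [set x | forall i, ((tnth x i)%:E < a i)%E].

(** Products of open lower half-lines, infinite bounds being allowed so as to include the whole
space and the cylinders. They form a pi-system that generates the Borel sets. *)
Definition ray_boxes : set (set T) := range ray_box.

Lemma measurable_ray (c : \bar R) : measurable [set y : measurableTypeR R | (y%:E < c)%E].
Proof.
rewrite -[X in measurable X]setTI; apply: emeasurable_fun_infty_o => //.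
Qed.

Lemma measurable_ray_box a : measurable (ray_box a).
Proof.
rewrite (_ : ray_box a = \bigcap_(i in [set: 'I_n]) ((fun x : T => tnth x i) @^-1` [set y | (y%:E < a i)%E])).
  apply: fin_bigcap_measurable => // i _.
  by rewrite -[X in measurable X]setTI; apply: measurable_tnth => //; exact: measurable_ray.
by apply/seteqP; split=> x //= h i; [move=> _; exact: h | exact: h].
Qed.

Lemma ray_boxesI : setI_closed ray_boxes.
Proof.
move=> _ _ [a _ <-] [b _ <-]; exists (fun i => Order.min (a i) (b i)) => //.
apply/seteqP; split => x /=.
  by move=> h; split => i; have := h i; rewrite lt_min => /andP[].
by move=> [ha hb] i; rewrite lt_min ha hb.
Qed.

Lemma measurable_ray_boxes : @measurable _ T = <<s ray_boxes >>.
Proof.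
apply/seteqP; split; last first.
  apply: smallest_sub; first exact: sigma_algebra_measurable.
  by move=> _ [a _ <-]; exact: measurable_ray_box.
pose T' := g_sigma_algebraType ray_boxes.
have mid : measurable_fun [set: T'] (id : T' -> n.-tuple (measurableTypeR R)).
  apply/measurable_fun_tnthP => i.
  apply: (@measurability _ _ _ _ _ _ (@RGenInftyO.G R)).
    exact: RGenInftyO.measurableE.
  move=> _ [_ [a ->] <-]; rewrite setTI; apply: sub_sigma_algebra.
  exists (fun j => if j == i then a%:E else +oo%E) => //.
  apply/seteqP; split => x /=.
    by move=> /(_ i); rewrite eqxx in_itv/= lte_fin.
  by rewrite in_itv/= => xa j; case: eqP => [->|_]; rewrite ?lte_fin ?ltry.
by move=> A mA; have := mid measurableT A mA; rewrite setTI.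
Qed.

End boxes.

(** * Almost everywhere convergence of Fejer means *)

Section almost_everywhere_convergence.
Import HBSimple.
Context {R : realType} (n : nat) (alpha : R).
Hypothesis sin_neq0 : sin alpha != 0.

Local Notation s := (torus_side alpha).
Local Notation mu := (torus_measure alpha n).
Local Notation Q := (@torus_cube R alpha n).
Local Notation T := (RT R n).
Let s0 : 0 < s. Proof. exact: torus_side_gt0. Qed.

(** The measure of the torus vanishes outside the cube and is the Lebesgue measure inside. *)
Lemma integral_torus_measure (f : T -> \bar R) : measurable_fun setT f -> (forall x, 0 <= f x)%E ->
  (\int[mu]_x f x = \int[lebesgue_tuple n]_(x in Q) f x)%E.
Proof.
move=> mf f0; have mQ := @measurable_torus_cube R alpha n.
rewrite (@ge0_negligible_integral _ _ _ mu setT (~` Q))//; last 2 first.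
- exact: measurableC.
- by rewrite torus_measureE setICl measure0.
rewrite setTD setCK; apply: eq_measure_integral => A mA AQ.
by rewrite [LHS]torus_measureE setIidl.
Qed.

Definition fejer_mean N (u : T -> R) (x : T) : R := s ^- n * \int[mu]_y (u y * fejer_kernel alpha N x y).

Lemma fejer_kernel_le N (x y : T) : fejer_kernel alpha N x y <= N.*2.+1%:R ^+ n.
Proof.
rewrite -[X in _ <= _ ^+ X]card_ord -prodr_const; apply: ler_prod => i _.
by rewrite rfejer_ge0 rfejer_le.
Qed.

Lemma integrable_mul_kernel N (x : T) (u : T -> R) : mu.-integrable setT (EFin \o u) ->
  mu.-integrable setT (EFin \o (fun y => u y * fejer_kernel alpha N x y)).
Proof.
move=> iu; apply: (integrableMl _ iu (measurable_fejer_kernelr alpha N x)) => //.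
exists (N.*2.+1%:R ^+ n); split; first by rewrite num_real.
move=> z zN y _ /=; rewrite ger0_norm ?fejer_kernel_ge0//.
by rewrite (le_trans (fejer_kernel_le _ _ _))// ltW.
Qed.

Lemma fejer_mean_linear N x (a b : R) (u v : T -> R) :
  mu.-integrable setT (EFin \o u) -> mu.-integrable setT (EFin \o v) ->
  fejer_mean N (fun y => a * u y + b * v y) x = a * fejer_mean N u x + b * fejer_mean N v x.
Proof.
move=> iu iv; rewrite /fejer_mean mulrCA (mulrCA b) -mulrDr; congr (_ * _).
have iZ (c : R) (w : T -> R) : mu.-integrable setT (EFin \o w) ->
    mu.-integrable setT (EFin \o (fun y => c * (w y * fejer_kernel alpha N x y))).
  move=> iw; have := integrableZl measurableT c (integrable_mul_kernel N x iw).
  by apply: eq_integrable.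
under eq_Rintegral do rewrite mulrDl -!mulrA.
by rewrite RintegralD ?RintegralZl//; try exact: iZ; exact: integrable_mul_kernel.
Qed.

(** The real-valued integral is the extended one, or 0 if the latter is infinite; in both cases the
triangle inequality survives. *)
Lemma fejer_mean_le N x (u : T -> R) : measurable_fun setT u ->
  (`|fejer_mean N u x|%:E <= (s ^- n)%:E * fejer_integral alpha N (fun y => `|u y|)%R x)%E.
Proof.
move=> meas_u.
rewrite /fejer_mean normrM (ger0_norm (_ : 0 <= s ^- n)) ?invr_ge0 ?exprn_ge0 ?(ltW s0)//.
rewrite EFinM; apply: lee_wpmul2l; first by rewrite lee_fin invr_ge0 exprn_ge0 ?(ltW s0).
have fineN (z : \bar R) : (`|fine z|%:E <= `|z|)%E by case: z => [r||] /=; rewrite ?lexx// normr0 leey.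
apply: le_trans (fineN _) _; apply: le_trans (le_abse_integral _ _ _) _ => //.
  by apply/measurable_EFinP; apply: measurable_funM => //; exact: measurable_fejer_kernelr.
rewrite le_eqVlt; apply/orP; left; apply/eqP; apply: eq_integral => y _.
by rewrite /= normrM (ger0_norm (fejer_kernel_ge0 _ _ _ _)).
Qed.

Definition fejer_convergent (u : T -> R) : Prop := mu.-integrable setT (EFin \o u) /\
  {ae mu, forall x, (fun N => fejer_mean N u x) @ \oo --> u x}.

Lemma fejer_convergent_linear (a b : R) (u v : T -> R) : fejer_convergent u -> fejer_convergent v -> fejer_convergent (fun y => a * u y + b * v y).
Proof.
move=> [iu cu] [iv cv]; split.
  have := integrableD measurableT (integrableZl measurableT a iu) (integrableZl measurableT b iv).
  by apply: eq_integrable.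
apply: filterS2 cu cv => x ux vx.
under eq_fun do rewrite fejer_mean_linear//.
by apply: cvgD; apply: cvgMl_tmp.
Qed.

(** The sets [C] obtained for a sequence of values of [e] tending to 0 are intersected. *)
Lemma negligible_small (B : set T) :
  (forall e : R, 0 < e -> exists C, [/\ measurable C, B `<=` C & (mu C <= e%:E)%E]) ->
  mu.-negligible B.
Proof.
move=> H; have [C HC] := choice (fun i : nat => H i.+1%:R^-1 ltac:(by rewrite invr_gt0 ltr0n)).
exists (\bigcap_i C i); split.
- by apply: bigcap_measurable => // i _; have [] := HC i.
- apply/eqP; rewrite eq_le measure_ge0 andbT; apply/lee_addgt0Pr => e e0.
  rewrite add0e.
  have [i ie] : exists i : nat, i.+1%:R^-1 < e.
    have [i _ Hi] := near_infty_natSinv_lt (PosNum e0).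
    by exists i; exact: (Hi i (leqnn i)).
  have [mC _ Ci] := HC i.
  apply: (@le_trans _ _ (mu (C i))); last by apply: le_trans Ci _; rewrite lee_fin ltW.
  apply: le_measure; rewrite ?inE//; last by move=> x; exact.
  by apply: bigcap_measurable => // j _; have [] := HC j.
- by move=> x Bx i _; have [_ BC _] := HC i; exact: BC.
Qed.

(** If [v] is close to [u] in L^1 and has convergent means, then the oscillation of the means of
[u] at [x] is controlled by the maximal function of [u - v] and by [u - v] itself, both small
outside of a set of small measure, by the weak type bound and by Markov's inequality. *)
Lemma fejer_convergent_closed (u : T -> R) : mu.-integrable setT (EFin \o u) ->
  (forall e : R, 0 < e -> exists2 v, fejer_convergent v & (\int[mu]_x (`|u x - v x|)%:E <= e%:E)%E) ->
  fejer_convergent u.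
Proof.
move=> iu H; split => //.
pose bad (j : nat) : set T := [set x | ~ (\forall N \near \oo, `|u x - fejer_mean N u x| <= j.+1%:R^-1)].
suff nbad j : mu.-negligible (bad j).
  apply: (negligibleS _ (negligible_bigcup nbad)) => x /= nx; apply: contrapT => nb.
  apply: nx; apply/cvgrPdist_le => e e0.
  have [j _ Hj] := near_infty_natSinv_lt (PosNum e0).
  have h : \forall N \near \oo, `|u x - fejer_mean N u x| <= j.+1%:R^-1.
    by apply: contrapT => h; apply: nb; exists j.
  apply: filterS h => N /le_trans; apply; rewrite ltW//.
  exact: (Hj j (leqnn j)).
apply: negligible_small => e e0.
have [A A0 AE] : exists2 A : R, 0 < A & A = 864 ^+ n.
  exists (864 ^+ n); last exact: erefl.
  by apply: exprn_gt0; rewrite ltr0n.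
(* The three errors add up to [A * l + l + l], which is [j.+1%:R^-1]. *)
pose l : R := j.+1%:R^-1 / (A + 2).
have l0 : 0 < l by rewrite !divr_gt0// ?addr_gt0.
have c0 : 0 < 6 ^+ n + 1 :> R by rewrite ltr_wpDl// exprn_ge0.
have [v [iv cv] uv] := H (e * l / (6 ^+ n + 1)) ltac:(by rewrite divr_gt0// mulr_gt0).
pose w y := `|u y - v y|.
have iw : mu.-integrable setT (EFin \o (fun y => u y - v y)).
  by have := integrableB measurableT iu iv; apply: eq_integrable.
have muv : measurable_fun setT (fun y => u y - v y).
  by move/integrableP : iw => [mw _]; exact/measurable_EFinP.
have mw : measurable_fun setT w by exact: measurableT_comp.
have w0 y : 0 <= w y by exact: normr_ge0.
have [Z [mZ Z0 vZ]] := cv.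
pose C1 := [set x | ((A * l)%:E < fejer_maximal alpha w x)%E].
pose C2 := [set x | (l%:E <= `|(EFin \o w) x|)%E].
have mC1 : measurable C1.
  rewrite -[X in measurable X]setTI; apply: emeasurable_fun_o_infty => //.
  exact: measurable_fejer_maximal.
have mC2 : measurable C2.
  rewrite -[X in measurable X]setTI; apply: emeasurable_fun_c_infty => //.
  by apply: measurableT_comp => //; exact/measurable_EFinP.
exists (Z `|` C1 `|` C2); split.
- by do 2? apply: measurableU.
- move=> x bx; apply: contrapT => /not_orP[/not_orP[nZ nC1] nC2]; apply: bx.
  have vx : fejer_mean N v x @[N --> \oo] --> v x.
    by apply: contrapT => nv; apply: nZ; apply: vZ.
  move/cvgrPdist_le : vx => /(_ _ l0) vx.
  apply: filterS vx => N vN.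
  have wl : w x <= l.
    rewrite leNgt; apply/negP => lw; apply: nC2.
    by rewrite /C2 /= lee_fin ger0_norm// ltW.
  have wN : `|fejer_mean N (fun y => u y - v y) x| <= A * l.
    rewrite -lee_fin; apply: le_trans (fejer_mean_le N x muv) _.
    rewrite leNgt; apply/negP => Aw; apply: nC1; apply: lt_le_trans Aw _.
    by apply: ereal_sup_ubound; exists N.
  have E : fejer_mean N (fun y => u y - v y) x = fejer_mean N u x - fejer_mean N v x.
    have := fejer_mean_linear N x 1 (-1) iu iv; rewrite mul1r mulN1r => <-; congr fejer_mean.
    by apply/funext => y; rewrite mul1r mulN1r.
  have -> : j.+1%:R^-1 = l + A * l + l.
    transitivity (l * (A + 2)); last by ring.
    by rewrite /l divfK// gt_eqF// addr_gt0.
  have -> : u x - fejer_mean N u x = (u x - v x) - fejer_mean N (fun y => u y - v y) x + (v x - fejer_mean N v x).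
    by rewrite E; ring.
  rewrite (le_trans (ler_normD _ _))// lerD// (le_trans (ler_normB _ _))//.
  by rewrite lerD.
- have le1 : (l%:E * mu C1 <= (6 ^+ n)%:E * \int[mu]_y (w y)%:E)%E.
    by rewrite /C1 AE; exact: weak_type.
  have le2 : (l%:E * mu C2 <= \int[mu]_y (w y)%:E)%E.
    have := @le_integral_abse _ _ _ mu setT measurableT (EFin \o w) l.
    rewrite setTI => /(_ _ l0) h; apply: le_trans (h _) _; first exact/measurable_EFinP.
    rewrite le_eqVlt; apply/orP; left; apply/eqP; apply: eq_integral => y _.
    by rewrite /= ger0_norm.
  have muC : (mu (Z `|` C1 `|` C2) <= mu C1 + mu C2)%E.
    apply: le_trans (measureU2 _ _ _) _ => //; first exact: measurableU.
    rewrite leeD2r//; apply: le_trans (measureU2 _ _ _) _ => //.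
    by rewrite -[leRHS]add0e leeD2r// le_eqVlt; apply/orP; left; apply/eqP; exact: Z0.
  apply: (le_trans muC); rewrite -(mulKf (lt0r_neq0 l0) e) EFinM lee_pdivlMl//.
  rewrite ge0_muleDr//; apply: le_trans (leeD le1 le2) _.
  rewrite -[X in (_ + X <= _)%E]mul1e -ge0_muleDl ?lee_fin ?exprn_ge0//.
  rewrite -EFinD; apply: (@le_trans _ _ ((6 ^+ n + 1)%:E * (e * l / (6 ^+ n + 1))%:E)%E).
    by apply: lee_wpmul2l => //; rewrite lee_fin ltW.
  by rewrite -!EFinM lee_fin mulrC divfK ?gt_eqF// mulrC.
Qed.

Lemma integrable_indic_torus (A : set T) : measurable A -> mu.-integrable setT (EFin \o \1_A).
Proof.
move=> mA; apply/integrableP; split; first by apply/measurable_EFinP; exact: measurable_indic.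
under eq_integral do rewrite /= ger0_norm//.
rewrite integral_indic// setIT; apply: le_lt_trans (torus_measure_fin n sin_neq0).
by apply: le_measure; rewrite ?inE.
Qed.

Lemma negligible_hyperplane (i : 'I_n) (c : R) : mu.-negligible [set x : T | tnth x i = c].
Proof.
pose A (j : 'I_n) : set (measurableTypeR R) := if j == i then [set c] else setT.
have mA j : measurable (A j) by rewrite /A; case: ifP.
have AE : [set x : T | forall j, A j (tnth x j)] = [set x : T | tnth x i = c].
  apply/seteqP; split => x /=; first by move=> /(_ i); rewrite /A eqxx.
  by move=> xi j; rewrite /A; case: eqP => [->|].
have mH : measurable [set x : T | tnth x i = c].
  rewrite (_ : mkset _ = (fun x : T => tnth x i) @^-1` [set c])//.
  by rewrite -[X in measurable X]setTI; apply: measurable_tnth => //; exact: measurable_set1.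
suff mu0 : mu [set x : T | tnth x i = c] = 0%E by apply/negligibleP.
apply/eqP; rewrite eq_le measure_ge0 andbT torus_measureE.
apply: (@le_trans _ _ (lebesgue_tuple n [set x : T | tnth x i = c])).
  apply: le_measure; rewrite ?inE//.
  by apply: measurableI => //; exact: measurable_torus_cube.
rewrite -AE lebesgue_tuple_box// (bigD1 i)//= {1}/A eqxx.
by rewrite lebesgue_measure_set1 mul0e.
Qed.

(** The kernel and the indicators of the box and of the cube are all products over the
coordinates. *)
Lemma fejer_mean_ray_box N (a : 'I_n -> \bar R) (x : T) :
  (forall i, - (s / 2) < tnth x i < s / 2) ->
  fejer_mean N (\1_(ray_box a)) x =
  \prod_(i < n) (fine (fejer_part s (tnth x i) N [set y | (y%:E < a i)%E]) / s).
Proof.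
move=> xs.
pose B i : set (measurableTypeR R) := `[- (s / 2), s / 2] `&` [set y | (y%:E < a i)%E].
have mB i : measurable (B i) by apply: measurableI; [exact: measurable_itv|exact: measurable_ray].
pose h i (y : measurableTypeR R) : R := rfejer N ((tnth x i - y) / s) * \1_(B i) y.
have mh i : measurable_fun setT (h i).
  apply: measurable_funM; last exact: measurable_indic.
  apply: (measurableT_comp (measurable_rfejer N)).
  by apply: measurable_funM => //; apply: measurable_funB.
have h0 i y : 0 <= h i y by rewrite mulr_ge0// rfejer_ge0.
have E : (\int[mu]_y (\1_(ray_box a) y * fejer_kernel alpha N x y)%:E =
    \prod_(i < n) fejer_part s (tnth x i) N [set y | (y%:E < a i)%E])%E.
  rewrite integral_torus_measure; last 2 first.
  - apply/measurable_EFinP; apply: measurable_funM; last exact: measurable_fejer_kernelr.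
    by apply: measurable_indic; exact: measurable_ray_box.
  - by move=> y; rewrite lee_fin mulr_ge0// fejer_kernel_ge0.
  rewrite integral_mkcond.
  transitivity (\int[lebesgue_tuple n]_y (\prod_(i < n) h i (tnth y i))%:E)%E.
    apply: eq_integral => y _; rewrite patchE.
    have [[Qy ay]|] := pselect (Q y /\ ray_box a y).
      rewrite mem_set// indicE mem_set// mul1r; congr EFin; apply: eq_bigr => i _.
      by rewrite /h indicE mem_set ?mulr1 ?rfejer_csc//; split; [exact: Qy|exact: ay].
    move=> /not_andP nQ.
    have [i nB] : exists i, ~ B i (tnth y i).
      apply: contrapT => /forallNP nB; have {}nB i : B i (tnth y i) by apply: contrapT; exact: nB.
      by case: nQ => nQ; apply: nQ => i; have [] := nB i.
    rewrite [RHS](_ : _ = 0%E); last first.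
      by rewrite (bigD1 i)//= /h indicE memNset// mulr0 mul0r.
    case: ifPn => // /set_mem Qy; case: nQ => // na.
    by rewrite indicE memNset// mul0r.
  rewrite integral_lebesgue_tuple_prod//; apply: eq_bigr => i _.
  rewrite /fejer_part [RHS]integral_mkcond; apply: eq_integral => y _.
  by rewrite patchE /h indicE; case: ifPn; rewrite ?mulr1 ?mulr0.
rewrite /fejer_mean /Rintegral E.
rewrite (eq_bigr (fun i => (fine (fejer_part s (tnth x i) N [set y | (y%:E < a i)%E]))%:E)); last first.
  move=> i _; rewrite fineK//; apply: fejer_part_fin => //; exact: measurable_ray.
rewrite prodEFin /= big_split /= prodfV prodr_const card_ord.
exact: mulrC.
Qed.

(** Convergence holds at the points of the open cube that are on none of the hyperplanes
bounding the box. *)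
Lemma fejer_convergent_ray_box a : fejer_convergent (\1_(ray_box a)).
Proof.
split; first by apply: integrable_indic_torus; exact: measurable_ray_box.
have nZ : mu.-negligible (~` Q `|` \big[setU/set0]_(i < n) ([set x | tnth x i = - (s / 2)] `|`
    [set x | tnth x i = s / 2] `|` [set x | tnth x i = fine (a i)])).
  apply: negligibleU.
    have mQ := @measurable_torus_cube R alpha n.
    suff mu0 : mu (~` Q) = 0%E by apply/negligibleP => //; exact: measurableC.
    by rewrite torus_measureE setICl measure0.
  elim/big_ind : _ => [|A B nA nB|i _]; first exact: negligible_set0.
    exact: negligibleU.
  by do 2? apply: negligibleU; exact: negligible_hyperplane.
apply: negligibleS nZ => x /= nx; apply: contrapT => nZ; apply: nx.
move/not_orP : nZ => [/contrapT Qx nH].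
have {}nH i : [/\ tnth x i <> - (s / 2), tnth x i <> s / 2 & tnth x i <> fine (a i)].
  split => h; apply: nH; rewrite -bigcup_seq; exists i; rewrite /= ?mem_index_enum//.
  - by left; left.
  - by left; right.
  - by right.
have xs i : - (s / 2) < tnth x i < s / 2.
  have /andP[h1 h2] := torus_cubeP i Qx; have [/eqP n1 /eqP n2 _] := nH i.
  by rewrite !lt_neqAle h1 h2 n2 eq_sym n1.
under eq_fun do rewrite fejer_mean_ray_box//.
have -> : \1_(ray_box a) x = \prod_(i < n) ((tnth x i \in [set y : R | (y%:E < a i)%E])%:R : R).
  rewrite indicE; have [ax|nax] := pselect (ray_box a x).
    by rewrite mem_set// big1// => i _; rewrite mem_set//; exact: ax.
  rewrite memNset//; move/existsNP : nax => [i ni].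
  by rewrite (bigD1 i)//= memNset// mul0r.
have := @cvg_big R 'I_n (@GRing.mul R) 1 xpredT (@mul_continuous R) nat \oo (index_enum 'I_n)
  (fun i N => fine (fejer_part s (tnth x i) N [set y | (y%:E < a i)%E]) / s)
  (fun i => (tnth x i \in [set y : R | (y%:E < a i)%E])%:R).
apply.
move=> i _; have [_ _ xa] := nH i.
have [e e0 He] : exists2 e : R, 0 < e &
    forall y, `|tnth x i - y| < e -> (y \in [set y : R | (y%:E < a i)%E]) =
      (tnth x i \in [set y : R | (y%:E < a i)%E]).
  have memE y : (y \in [set y : R | (y%:E < a i)%E]) = (y%:E < a i)%E.
    by apply/idP/idP => [/set_mem//|h]; apply/mem_set.
  case: (a i) xa memE => [c| |] /= xa memE.
  - exists `|tnth x i - c|; first by rewrite normr_gt0 subr_eq0; exact/eqP.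
    move=> y; rewrite !memE !lte_fin; have [xc|cx] := ltP (tnth x i) c.
      by rewrite (ltr0_norm (_ : tnth x i - c < 0)) ?subr_lt0// ltr_norml => h; apply/idP; lra.
    rewrite (ger0_norm (_ : 0 <= tnth x i - c)) ?subr_ge0// ltr_norml => h.
    by apply/negbTE; rewrite -leNgt; lra.
  - by exists 1 => // y _; rewrite !memE !ltry.
  - by exists 1 => // y _; rewrite !memE.
exact: (fejer_part_cvg s0 (xs i) e0 (measurable_ray (a i)) He).
Qed.

Lemma eq_fejer_convergent (u v : T -> R) : u =1 v -> fejer_convergent u -> fejer_convergent v.
Proof. by move=> /funext ->. Qed.

Lemma fejer_convergent_setT : fejer_convergent (\1_(setT : set T)).
Proof.
have <- : ray_box (fun=> +oo%E) = setT :> set T.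
  by apply/seteqP; split => // x _ i; rewrite ltry.
exact: fejer_convergent_ray_box.
Qed.

Lemma fejer_convergent_sum (I : Type) (r : seq I) (c : I -> R) (u : I -> T -> R) :
  (forall i, fejer_convergent (u i)) -> fejer_convergent (fun x => \sum_(i <- r) c i * u i x).
Proof.
move=> gu; elim: r => [|i r IH].
  apply: (eq_fejer_convergent _ (fejer_convergent_linear 0 0 fejer_convergent_setT fejer_convergent_setT)) => x.
  by rewrite big_nil !mul0r addr0.
apply: (eq_fejer_convergent _ (fejer_convergent_linear (c i) 1 (gu i) IH)) => x.
by rewrite big_cons mul1r.
Qed.

(** Dynkin's pi-lambda argument: the sets whose indicators have convergent means are stable under
complement by linearity, and under countable disjoint union by closedness in L^1. *)
Lemma fejer_convergent_indic (A : set T) : measurable A -> fejer_convergent (\1_A).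
Proof.
rewrite measurable_ray_boxes; move: A.
apply: (@dynkin_induction _ _ (@ray_boxes R n) (fun A : set T => fejer_convergent (\1_A))).
- exact: measurable_ray_boxes.
- exact: ray_boxesI.
- exact: fejer_convergent_setT.
- by move=> _ [a _ <-]; exact: fejer_convergent_ray_box.
- move=> S mS gS; apply: (eq_fejer_convergent _ (fejer_convergent_linear 1 (-1) fejer_convergent_setT gS)) => x.
  rewrite !indicE in_setT in_setC mul1r mulN1r.
  by case: (x \in S); rewrite ?subrr ?subr0.
move=> F mF tF gF.
have mU : measurable (\bigcup_k F k) by exact: bigcup_measurable.
apply: fejer_convergent_closed; first exact: integrable_indic_torus.
move=> e e0.
pose V K := \big[setU/set0]_(i < K) F i.
have mV K : measurable (V K) by exact: bigsetU_measurable.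
have gV K : fejer_convergent (\1_(V K)).
  elim: K => [|K IH].
    apply: (eq_fejer_convergent _ (fejer_convergent_linear 0 0 fejer_convergent_setT fejer_convergent_setT)) => x.
    by rewrite /V big_ord0 !mul0r addr0 indicE memNset.
  apply: (eq_fejer_convergent _ (fejer_convergent_linear 1 1 IH (gF K))) => x.
  rewrite !mul1r [in RHS]/V big_ord_recr /= -/(V K) !indicE in_setU.
  have [xV|//] := boolP (x \in V K); last by rewrite add0r.
  rewrite (_ : x \in F K = false) ?addr0//; apply/negbTE/negP => /set_mem xF.
  move/set_mem : xV; rewrite /V -bigcup_mkord => -[i /= iK xi].
  have iE := tF i K Logic.I Logic.I (ex_intro _ x (conj xi xF)).
  by rewrite iE ltnn in iK.
have VU K : V K `<=` \bigcup_k F k by exact: bigsetU_bigcup.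
have UV : \bigcup_k F k = \bigcup_K V K.
  apply/seteqP; split => x [k _]; last exact: VU.
  by exists k.+1 => //; rewrite /V big_ord_recr; right.
have ndV : nondecreasing_seq V by move=> i j ij; apply/subsetPset; exact: subset_bigsetU.
have cv : mu \o V @ \oo --> mu (\bigcup_k F k).
  by rewrite UV; apply: nondecreasing_cvg_mu => //; rewrite -UV.
have finT (B : set T) : measurable B -> mu B \is a fin_num.
  move=> mB; rewrite ge0_fin_numE//; apply: le_lt_trans (torus_measure_fin n sin_neq0).
  by apply: le_measure; rewrite ?inE.
rewrite -(fineK (finT _ mU)) in cv.
move/fine_cvgP : cv => [_ /cvgrPdist_le /(_ _ e0)[K _ /(_ K (leqnn K)) HK]].
have {}HK : `|fine (mu (\bigcup_k F k)) - fine (mu (V K))| <= e by exact: HK.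
exists (\1_(V K)); first exact: gV.
have E x : `|\1_(\bigcup_k F k) x - \1_(V K) x| = \1_(\bigcup_k F k `\` V K) x :> R.
  rewrite !indicE in_setD; have [xV|xV] := boolP (x \in V K).
    by rewrite (mem_set (VU K _ (set_mem xV))) subrr normr0.
  by rewrite subr0 andbT ger0_norm.
under eq_integral do rewrite E.
rewrite integral_indic//; last exact: measurableD.
rewrite setIT measureD//; last by rewrite -ge0_fin_numE// finT.
rewrite (setIidr (VU K)) -[leLHS]/((mu (\bigcup_k F k) - mu (V K))%E) -(fineK (finT _ mU)) -(fineK (finT _ (mV K))) -EFinB lee_fin.
exact: le_trans (ler_norm _) HK.
Qed.

Lemma fejer_convergent_integrable (u : T -> R) : mu.-integrable setT (EFin \o u) -> fejer_convergent u.
Proof.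
move=> iu; apply: fejer_convergent_closed => // e e0.
have [g [ig _ cg]] := approximation_sfun_integrable measurableT iu.
have gg k : fejer_convergent (g k).
  pose v x := \sum_(y <- finmap.enum_fset (fset_set (range (g k)))) y * \1_(g k @^-1` [set y]) x.
  have vE : v = g k by apply/funext => x; rewrite [RHS]fimfunE fsbig_finite.
  rewrite -vE; apply: fejer_convergent_sum => y; apply: fejer_convergent_indic.
  exact: measurable_funPTI.
move/fine_cvgP : cg => [[K1 _ H1] /cvgrPdist_le /(_ _ e0)[K2 _ H2]].
exists (g (maxn K1 K2)) => //.
have := H1 _ (leq_maxl K1 K2); have := H2 _ (leq_maxr K1 K2).
rewrite /= sub0r normrN => h2 h1.
rewrite -(fineK h1) lee_fin; exact: le_trans (ler_norm _) h2.
Qed.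

End almost_everywhere_convergence.

(** * Zeros of the sine, and moduli of complex numbers *)

Section sin_zero.
Context {R : realType}.

Lemma sin_int_mul_pi (k : int) : sin (k%:~R * pi) = 0 :> R.
Proof.
have H (m : nat) : sin (m%:R * pi) = 0 :> R.
  elim: m => [|m IH]; first by rewrite mul0r sin0.
  by rewrite -natr1 mulrDl mul1r sinDpi IH oppr0.
by case: k => m; [exact: H|rewrite NegzE mulrNz mulNr sinN H oppr0].
Qed.

(** Subtracting the integral multiple of pi just below [alpha] leads to the open interval from 0
to pi, where the sine is positive. *)
Lemma sin_neq0_of_not_int_mul_pi (alpha : R) :
  (forall k : int, alpha <> k%:~R * pi) -> sin alpha != 0.
Proof.
move=> H; apply/eqP => s0; have p0 := pi_gt0 R.
pose q := Num.floor (alpha / pi); pose r := alpha - q%:~R * pi.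
have /andP[q1 q2] := floor_itv (alpha / pi); rewrite -/q in q1 q2.
have : 0 < sin r.
  apply: sin_gt0_pi; rewrite /r subr_gt0 ltrBlDl; apply/andP; split.
    rewrite lt_neqAle -ler_pdivlMr// q1 andbT; apply/eqP => E; exact: (H q).
  by move: q2; rewrite ltr_pdivrMr// rmorphD /= mulrDl mul1r.
by rewrite sinB s0 mul0r sin_int_mul_pi mulr0 subrr ltxx.
Qed.

End sin_zero.

Section complex_modulus.
Context {R : realType}.
Implicit Types z : R[i].

Lemma normc_ReImE (a b : R) : Normc.normc (a +i* b)%C = Num.sqrt (a ^+ 2 + b ^+ 2).
Proof. by []. Qed.

Lemma normc_ge0 z : 0 <= Normc.normc z.
Proof. by case: z => a b; rewrite sqrtr_ge0. Qed.

Lemma normc_le z : Normc.normc z <= `|complex.Re z| + `|complex.Im z|.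
Proof.
case: z => a b; rewrite normc_ReImE /=.
rewrite -[leRHS]ger0_norm ?addr_ge0// -sqrtr_sqr ler_wsqrtr//.
rewrite sqrrD !real_normK ?num_real//.
by rewrite addrAC lerDl mulrn_wge0// mulr_ge0.
Qed.

Lemma Re_le_normc z : `|complex.Re z| <= Normc.normc z.
Proof. by case: z => a b; rewrite normc_ReImE /= -sqrtr_sqr ler_wsqrtr// lerDl sqr_ge0. Qed.

Lemma Im_le_normc z : `|complex.Im z| <= Normc.normc z.
Proof. by case: z => a b; rewrite normc_ReImE /= -sqrtr_sqr ler_wsqrtr// lerDr sqr_ge0. Qed.

Lemma normc_cexpi (t : R) : Normc.normc (cexpi t) = 1.
Proof. by rewrite normc_ReImE cos2Dsin2 sqrtr1. Qed.

Lemma cexpiN_mul (t : R) : cexpi t * cexpi (- t) = 1.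
Proof.
rewrite /cexpi cosN sinN; apply/eqP; rewrite eq_complex /=.
by rewrite !mulrN opprK -!expr2 cos2Dsin2 (mulrC (cos t)) addNr !eqxx.
Qed.

Lemma normrcE z : `|z| = (Normc.normc z)%:C%C.
Proof. by rewrite normc_def; case: z. Qed.

Lemma measurable_normc d (T : measurableType d) (a b : T -> R) :
  measurable_fun setT a -> measurable_fun setT b ->
  measurable_fun setT (fun x => Normc.normc (a x +i* b x)%C).
Proof.
move=> ma mb.
have mab : measurable_fun setT (fun x => a x ^+ 2 + b x ^+ 2).
  by apply: measurable_funD; exact: measurable_funX.
exact: (measurableT_comp (continuous_measurable_fun (@sqrt_continuous R)) mab).
Qed.

Lemma cvg_complex (a b : nat -> R) (la lb : R) (c : R[i]) : Normc.normc c = 1 ->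
  a @ \oo --> la -> b @ \oo --> lb ->
  (fun N => c * (a N +i* b N)%C : R[i]^o) @ \oo --> (c * (la +i* lb)%C : R[i]^o).
Proof.
move=> c1 ca cb; apply/cvgrPdist_lt => e; rewrite ltcE /= => /andP[/eqP eI e0].
have e2 : 0 < complex.Re e / 2 by rewrite divr_gt0.
move/cvgrPdist_lt : ca => /(_ _ e2) ca; move/cvgrPdist_lt : cb => /(_ _ e2) cb.
apply: filterS2 ca cb => N aN bN.
have h : Normc.normc ((la +i* lb)%C - (a N +i* b N)%C) < complex.Re e.
  apply: le_lt_trans (normc_le _) _.
  by rewrite [ltRHS]splitr; exact: ltrD.
rewrite -mulrBr normrM !normrcE c1 -[1%:C%C]/(1 : R[i]) mul1r ltcE eI.
by apply/andP; split; [exact: eqxx|exact: h].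
Qed.

End complex_modulus.

(** * Bounds for the fractional maximal function *)

Section maximal_bounds.
Context {R : realType} (n : nat) (alpha : R).
Hypothesis sin_neq0 : sin alpha != 0.

Local Notation s := (torus_side alpha).
Local Notation mu := (torus_measure alpha n).
Local Notation Q := (@torus_cube R alpha n).
Local Notation T := (RT R n).
Local Notation M := (fejer_maximal alpha).
Let s0 : 0 < s. Proof. exact: torus_side_gt0. Qed.

Lemma maxr0_pMl (a k : R) : 0 <= k -> Num.max (a * k) 0 = Num.max a 0 * k.
Proof. by move=> k0; rewrite maxr_pMl// mul0r. Qed.

(** The integrand splits into positive and negative parts along with [u], because the kernel is
nonnegative; Tonelli's theorem applies to both. *)
Lemma measurable_fejer_mean N (u : T -> R) : measurable_fun setT u -> measurable_fun setT (fejer_mean alpha N u).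
Proof.
move=> meas_u.
pose up y := Num.max (u y) 0; pose un y := Num.max (- u y) 0.
have mup : measurable_fun setT up by apply: measurable_maxr.
have mun : measurable_fun setT un.
  by apply: measurable_maxr => //; exact: measurableT_comp.
have up0 y : 0 <= up y by rewrite le_max lexx orbT.
have un0 y : 0 <= un y by rewrite le_max lexx orbT.
have -> : fejer_mean alpha N u = fun x => s ^- n * fine (fejer_integral alpha N up x - fejer_integral alpha N un x)%E.
  apply/funext => x; rewrite /fejer_mean /Rintegral; congr (_ * fine _).
  rewrite integralE; congr (_ - _)%E; apply: eq_integral => y _.
    by rewrite funeposE /= -EFin_max maxr0_pMl ?fejer_kernel_ge0.
  by rewrite funenegE /= -EFin_max -mulNr maxr0_pMl ?fejer_kernel_ge0.
apply: measurable_funM => //; apply: (measurableT_comp (fine_measurable (@measurableT _ _))).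
by apply: emeasurable_funB; exact: measurable_fejer_integral.
Qed.

Lemma pow864_gt0 : (0 < 864 ^+ n :> R).
Proof. by apply: exprn_gt0; rewrite ltr0n. Qed.

(** Through this, an element of a chirped Lebesgue space is replaced by a Borel representative. *)
Lemma ae_eq_torus_Lnorm (p : \bar R) (h1 h2 : T -> \bar R) : (1 <= p)%E ->
  h1 = h2 %[ae mu] -> torus_Lnorm alpha p h1 = torus_Lnorm alpha p h2.
Proof.
rewrite /torus_Lnorm unlock; case: p => [r| |//] _ h12.
  congr (_ `^ _)%E; apply: ae_eq_integral_nonmeasurable.
  by apply: filterS h12 => x h _; rewrite h.
have le (u v : T -> \bar R) : u = v %[ae mu] -> (ess_sup mu (abse \o u) <= ess_sup mu (abse \o v))%E.
  move=> uv; apply/ess_supP; have := ess_sup_ge mu (abse \o v).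
  by apply: filterS2 uv => x h; rewrite /= h.
case: ifP => // _; apply/eqP; rewrite eq_le !le//.
by apply: filterS h12 => x h _; rewrite h.
Qed.

(** The translation by one period that occurs in the definition of periodicity. *)
Definition torus_shift (j : 'I_n) (x : T) : T :=
  [tuple tnth x i + (if i == j then s else 0) | i < n].

Lemma fejer_kernel_shift N (j : 'I_n) (x y : T) : fejer_kernel alpha N (torus_shift j x) y = fejer_kernel alpha N x y.
Proof.
apply: eq_bigr => i _; rewrite tnth_mktuple; case: eqP => _; last by rewrite addr0.
rewrite addrAC mulrDl.
have [e ->] : exists e : int, s * csc alpha = e%:~R.
  rewrite /torus_side /csc; have [s_ge0|s_lt0] := leP 0 (sin alpha).
    by exists 1; rewrite ger0_norm// divff.
  by exists (-1); rewrite ltr0_norm// mulNr divff.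
by rewrite rfejerDz.
Qed.

Lemma fejer_integralD N (u v : T -> R) x : measurable_fun setT u -> measurable_fun setT v ->
  (forall y, 0 <= u y) -> (forall y, 0 <= v y) ->
  fejer_integral alpha N (fun y => u y + v y) x = (fejer_integral alpha N u x + fejer_integral alpha N v x)%E.
Proof.
move=> meas_u mv u0 v0; rewrite /fejer_integral -ge0_integralD//.
- by apply: eq_integral => y _; rewrite mulrDl EFinD.
- by move=> y _; rewrite lee_fin mulr_ge0// fejer_kernel_ge0.
- by apply/measurable_EFinP; apply: measurable_funM => //; exact: measurable_fejer_kernelr.
- by move=> y _; rewrite lee_fin mulr_ge0// fejer_kernel_ge0.
- by apply/measurable_EFinP; apply: measurable_funM => //; exact: measurable_fejer_kernelr.
Qed.

Lemma le_fejer_integral N (u v : T -> R) x : measurable_fun setT u -> measurable_fun setT v ->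
  (forall y, 0 <= u y <= v y) -> (fejer_integral alpha N u x <= fejer_integral alpha N v x)%E.
Proof.
move=> meas_u mv uv; apply: ge0_le_integral => //.
- by move=> y _; have /andP[u0 _] := uv y; rewrite lee_fin mulr_ge0// fejer_kernel_ge0.
- by apply/measurable_EFinP; apply: measurable_funM => //; exact: measurable_fejer_kernelr.
- by apply/measurable_EFinP; apply: measurable_funM => //; exact: measurable_fejer_kernelr.
- by move=> y _; have /andP[_ ?] := uv y; rewrite lee_fin ler_wpM2r// fejer_kernel_ge0.
Qed.

Lemma fejer_maximal_ub N (u : T -> R) x : ((s ^- n)%:E * fejer_integral alpha N u x <= M u x)%E.
Proof. by apply: ereal_sup_ubound; exists N. Qed.

Lemma fejer_maximal_subadd (u v : T -> R) x : measurable_fun setT u -> measurable_fun setT v ->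
  (forall y, 0 <= u y) -> (forall y, 0 <= v y) ->
  (M (fun y => u y + v y)%R x <= M u x + M v x)%E.
Proof.
move=> meas_u mv u0 v0; apply: ge_ereal_sup => _ [N _ <-].
rewrite fejer_integralD// ge0_muleDr ?fejer_integral_ge0//.
by apply: leeD; exact: fejer_maximal_ub.
Qed.

(** Marcinkiewicz's splitting of [w] at height [l]: the small part contributes at most
[864 ^+ n * l] to the maximal function, and the weak type bound applies to the large part. *)
Lemma fejer_maximal_level (w : T -> R) (l : R) : measurable_fun setT w -> (forall y, 0 <= w y) -> 0 < l ->
  (l%:E * mu [set x | ((2 * 864 ^+ n * l)%:E < M w x)%E] <=
    (6 ^+ n)%:E * \int[mu]_(x in [set x | (l < w x)%R]) (w x)%:E)%E.
Proof.
move=> mw w0 l0.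
have mL : measurable [set x | l < w x].
  rewrite (_ : mkset _ = w @^-1` `]l, +oo[); last first.
    by apply/seteqP; split => x /=; rewrite in_itv/= andbT.
  by rewrite -[X in measurable X]setTI; exact: mw.
pose w1 y := w y * \1_[set x | l < w x] y.
pose w2 y := w y * \1_(~` [set x | l < w x]) y.
have mw1 : measurable_fun setT w1 by apply: measurable_funM => //; exact: measurable_indic.
have mw2 : measurable_fun setT w2.
  by apply: measurable_funM => //; apply: measurable_indic; exact: measurableC.
have w10 y : 0 <= w1 y by rewrite mulr_ge0.
have w20 y : 0 <= w2 y by rewrite mulr_ge0.
have w12 : w = fun y => w1 y + w2 y.
  apply/funext => y; rewrite /w1 /w2 -mulrDr !indicE in_setC.
  by case: (_ \in _); rewrite ?addr0 ?add0r mulr1.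
have w2l y : w2 y <= l.
  rewrite /w2 indicE in_setC; case: (boolP (y \in _)) => [_|ny].
    by rewrite mulr0 ltW.
  by rewrite mulr1 leNgt; apply: contra ny => h; exact/mem_set.
have mM (u : T -> R) (r : R) : measurable_fun setT u -> (forall y, 0 <= u y) ->
    measurable [set x | (r%:E < M u x)%E].
  move=> meas_u u0; rewrite -[X in measurable X]setTI; apply: emeasurable_fun_o_infty => //.
  exact: measurable_fejer_maximal.
rewrite -integral_mul_indic.
apply: le_trans (weak_type sin_neq0 mw1 w10 l0).
apply: lee_wpmul2l; first by rewrite lee_fin ltW.
rewrite torus_measureE [leRHS]torus_measureE; apply: le_measure; rewrite ?inE.
- by apply: measurableI; [exact: mM|exact: measurable_torus_cube].
- by apply: measurableI; [exact: mM|exact: measurable_torus_cube].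
move=> x [/= h Qx]; split => //=; rewrite ltNge; apply/negP => h1.
move: h; apply/negP; rewrite -leNgt [in leLHS]w12.
apply: le_trans (fejer_maximal_subadd x mw1 mw2 w10 w20) _.
have h2 : (M w2 x <= (864 ^+ n * l)%:E)%E.
  by apply: fejer_maximal_le => //; [exact: ltW|exact: nearW].
apply: le_trans (leeD h1 h2) _.
by rewrite -EFinD lee_fin -mulrA mulr_natl mulr2n.
Qed.

Section one_function.
Variables (f g : T -> R[i]).
Hypothesis mg : measurable_cfun g.
Hypothesis fg : f = (fun x => chirpN alpha x * g x) %[ae mu].

Let w y : R := Normc.normc (g y).
Let gr y : R := complex.Re (g y).
Let gi y : R := complex.Im (g y).
Let w0 y : 0 <= w y. Proof. exact: normc_ge0. Qed.
Let mgr : measurable_fun setT gr. Proof. by case: mg. Qed.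
Let mgi : measurable_fun setT gi. Proof. by case: mg. Qed.
Let mw : measurable_fun setT w.
Proof.
have := measurable_normc mgr mgi; apply: eq_measurable_fun => y _.
by rewrite /w /gr /gi; case: (g y).
Qed.

Lemma fejer_scaledE N (x y : T) :
  fejer n N [tuple (tnth x i - tnth y i) * csc alpha | i < n] = (fejer_kernel alpha N x y)%:C%C.
Proof.
rewrite /fejer /fejer_kernel (rmorph_prod (real_complex R)); apply: eq_bigr => i _.
by rewrite tnth_mktuple fejer1E.
Qed.

(** The chirps cancel almost everywhere under the integral, and the kernel is real, so that the
complex integral is made of the Fejer means of the real and imaginary parts of [g]. *)
Lemma frac_conv_fejerE N x : frac_conv alpha f (fejer n N) x =
  chirpN alpha x * (fejer_mean alpha N gr x +i* fejer_mean alpha N gi x)%C.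
Proof.
have ae_id : (fun y => chirp alpha y * f y) = g %[ae mu].
  apply: filterS fg => y h _; rewrite h// mulrA /chirp /chirpN cexpiN_mul mul1r//.
have csE : `|csc alpha| ^+ n = s ^- n by rewrite /csc normfV exprVn.
rewrite /frac_conv csE mulrAC mulrC; congr (_ * _).
rewrite /cintegral /fejer_mean.
have -> : \int[mu]_y complex.Re (chirp alpha y * f y * fejer n N [tuple (tnth x i - tnth y i) * csc alpha | i < n])
   = \int[mu]_y (gr y * fejer_kernel alpha N x y).
  rewrite /Rintegral; congr fine; apply: ae_eq_integral_nonmeasurable.
  apply: filterS ae_id => y h _; rewrite h// fejer_scaledE /gr.
  by case: (g y) => a b /=; rewrite mulr0 subr0.
have -> : \int[mu]_y complex.Im (chirp alpha y * f y * fejer n N [tuple (tnth x i - tnth y i) * csc alpha | i < n])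
   = \int[mu]_y (gi y * fejer_kernel alpha N x y).
  rewrite /Rintegral; congr fine; apply: ae_eq_integral_nonmeasurable.
  apply: filterS ae_id => y h _; rewrite h// fejer_scaledE /gi.
  by case: (g y) => a b /=; rewrite mulr0 add0r.
by apply/eqP; rewrite eq_complex /= !mul0r subr0 addr0 !eqxx.
Qed.

Lemma cabs_frac_conv N x : cabs (frac_conv alpha f (fejer n N)) x =
  (Normc.normc (fejer_mean alpha N gr x +i* fejer_mean alpha N gi x)%C)%:E.
Proof. by rewrite /cabs frac_conv_fejerE Normc.normcM normc_cexpi mul1r. Qed.

(** The factor 2 comes from treating the real and imaginary parts separately. *)
Lemma frac_maximal_le x : (frac_maximal alpha f x <= 2%:E * M w x)%E.
Proof.
apply: ge_ereal_sup => _ [N _ <-]; rewrite cabs_frac_conv.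
have H (u : T -> R) : measurable_fun setT u -> (forall y, `|u y| <= w y) ->
    (`|fejer_mean alpha N u x|%:E <= M w x)%E.
  move=> meas_u uw; apply: le_trans (fejer_mean_le sin_neq0 N x meas_u) _.
  apply: le_trans (fejer_maximal_ub N w x); apply: lee_wpmul2l.
    by rewrite lee_fin invr_ge0 exprn_ge0// ltW.
  apply: le_fejer_integral => //; first exact: measurableT_comp.
  by move=> y; rewrite normr_ge0 uw.
apply: (@le_trans _ _ (`|fejer_mean alpha N gr x|%:E + `|fejer_mean alpha N gi x|%:E)%E).
  by rewrite -EFinD lee_fin; exact: normc_le.
rewrite mule_natl mule2n; apply: leeD; apply: H => // y; [exact: Re_le_normc|exact: Im_le_normc].
Qed.

Lemma frac_maximal_ge0 x : (0 <= frac_maximal alpha f x)%E.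
Proof.
apply: (@le_trans _ _ (cabs (frac_conv alpha f (fejer n 1)) x)).
  by rewrite lee_fin normc_ge0.
by apply: ereal_sup_ubound; exists 1%N.
Qed.

Lemma measurable_frac_maximal : measurable_fun setT (frac_maximal alpha f).
Proof.
rewrite (_ : frac_maximal alpha f = fun x => ereal_sup [set (Normc.normc (fejer_mean alpha N gr x +i* fejer_mean alpha N gi x)%C)%:E | N in [set N | (1 <= N)%N]]).
  apply: (@measurable_fun_esups _ _ _ setT
    (fun N x => (Normc.normc (fejer_mean alpha N gr x +i* fejer_mean alpha N gi x)%C)%:E) _ 1%N).
  move=> N; apply/measurable_EFinP.
  by apply: measurable_normc; exact: measurable_fejer_mean.
apply/funext => x; congr ereal_sup; apply/seteqP; split => _ [N N0 <-]; exists N => //.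
  by rewrite cabs_frac_conv.
by rewrite cabs_frac_conv.
Qed.

Lemma frac_maximal_periodic : torus_periodic alpha (frac_maximal alpha f).
Proof.
move=> j x; congr ereal_sup; apply: eq_imagel => N _.
rewrite !cabs_frac_conv.
have fejer_mean_shift u : fejer_mean alpha N u (torus_shift j x) = fejer_mean alpha N u x.
  by rewrite /fejer_mean; congr (_ * _); apply: eq_Rintegral => y _; rewrite fejer_kernel_shift.
by rewrite -!/(torus_shift j x) !fejer_mean_shift.
Qed.


Lemma ae_eq_cabs : cabs f = EFin \o w %[ae mu].
Proof.
apply: filterS fg => y h _; rewrite /cabs h// Normc.normcM normc_cexpi mul1r//.
Qed.

Lemma frac_maximal_gt_le (l : R) :
  (mu [set x | (l%:E < `|frac_maximal alpha f x|)%E] <= mu [set x | ((l / 2)%:E < M w x)%E])%E.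
Proof.
apply: le_measure; rewrite ?inE.
- rewrite -[X in measurable X]setTI; apply: emeasurable_fun_o_infty => //.
  by apply: measurableT_comp => //; exact: measurable_frac_maximal.
- rewrite -[X in measurable X]setTI; apply: emeasurable_fun_o_infty => //.
  exact: measurable_fejer_maximal.
move=> x /=; rewrite gee0_abs ?frac_maximal_ge0// => h.
have := lt_le_trans h (frac_maximal_le x).
by rewrite -lte_pdivrMl// -EFinM mulrC.
Qed.

Lemma weak_type_frac_maximal :
  (torus_weakL1norm alpha (frac_maximal alpha f) <=
    (2 * 864 ^+ n * 6 ^+ n)%:E * torus_Lnorm alpha 1 (cabs f))%E.
Proof.
have A0 := pow864_gt0; set A : R := 864 ^+ n in A0 *.
rewrite (ae_eq_torus_Lnorm _ ae_eq_cabs)// /torus_Lnorm Lnorm1.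
under eq_integral => y _ do rewrite /= ger0_norm//.
apply: ge_ereal_sup => _ [l /= l0 <-].
apply: (@le_trans _ _ (l%:E * mu [set x | ((l / 2)%:E < M w x)%E])%E).
  by apply: lee_wpmul2l; [rewrite lee_fin ltW|exact: frac_maximal_gt_le].
pose l' := l / 2 / A.
have l'0 : 0 < l' by rewrite !divr_gt0.
have -> : l / 2 = 864 ^+ n * l' by rewrite -/A /l' [RHS]mulrC divfK// gt_eqF.
have -> : l = 2 * A * l' by rewrite /l'; field; rewrite gt_eqF.
rewrite EFinM -muleA [in leRHS]EFinM -muleA; apply: lee_wpmul2l.
  by rewrite lee_fin mulr_ge0// ltW.
exact: weak_type.
Qed.

Lemma Lnorm_oo_frac_maximal :
  (torus_Lnorm alpha +oo (cabs f) < +oo)%E ->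
  (torus_Lnorm alpha +oo (frac_maximal alpha f) <=
    (2 * 864 ^+ n)%:E * torus_Lnorm alpha +oo (cabs f))%E.
Proof.
have A0 := pow864_gt0; set A : R := 864 ^+ n in A0 *.
rewrite (ae_eq_torus_Lnorm (leey _) ae_eq_cabs) /torus_Lnorm unlock.
case: ifPn => [mu0|_ _]; last by rewrite mule0.
set E := ess_sup mu _ => Efin.
have wE := ess_sup_ge mu (abse \o (EFin \o w)); rewrite -/E in wE.
have E0 : (0 <= E)%E by apply: ess_sup_gee => //; apply: nearW => y; exact: abse_ge0.
have EE : E = (fine E)%:E by rewrite fineK// ge0_fin_numE.
apply/ess_supP.
have mQ := @measurable_torus_cube R alpha n.
exists (~` Q); split; first exact: measurableC.
  by rewrite torus_measureE setICl measure0.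
move=> x /=; apply: contra_not => Qx.
rewrite gee0_abs ?frac_maximal_ge0//; apply: le_trans (frac_maximal_le x) _.
rewrite EFinM -muleA; apply: lee_wpmul2l => //.
rewrite EE -EFinM; apply: fejer_maximal_le => //; first by rewrite fine_ge0.
by apply: filterS wE => y; rewrite /= ger0_norm// -lee_fin -EE.
Qed.

Lemma Lnorm_p_frac_maximal (r : R) : 1 < r ->
  (torus_Lnorm alpha r%:E (frac_maximal alpha f) <=
    (((2 * (4 * 864 ^+ n)) `^ r * 6 ^+ n * (2 `^ (r - 1) / (2 `^ (r - 1) - 1))) `^ r^-1)%:E *
     torus_Lnorm alpha r%:E (cabs f))%E.
Proof.
move=> r1; have A0 := pow864_gt0.
rewrite (ae_eq_torus_Lnorm _ ae_eq_cabs) ?lee_fin ?(ltW r1)// /torus_Lnorm unlock.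
have r0 : 0 <= r^-1 by rewrite invr_ge0 ltW// (lt_trans ltr01).
under eq_integral => y _ do rewrite gee0_abs ?frac_maximal_ge0//.
under [X in (_ <= _ * X `^ _)%E]eq_integral => y _ do rewrite /= ger0_norm//.
have level l : 0 < l -> (l%:E * mu [set x | ((4 * 864 ^+ n * l)%:E < frac_maximal alpha f x)%E] <=
    (6 ^+ n)%:E * \int[mu]_(x in [set x | (l < w x)%R]) (w x)%:E)%E.
  move=> l0; apply: le_trans (fejer_maximal_level mw w0 l0).
  apply: lee_wpmul2l; first by rewrite lee_fin ltW.
  have := frac_maximal_gt_le (4 * 864 ^+ n * l).
  under eq_set => x do rewrite gee0_abs ?frac_maximal_ge0//.
  by rewrite (_ : 4 * 864 ^+ n * l / 2 = 2 * 864 ^+ n * l)//; field.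
have c0 : (0 <= 6 ^+ n :> R) by rewrite exprn_ge0.
have a0 : 0 < 4 * 864 ^+ n :> R by rewrite mulr_gt0.
have := interpolation mw w0 measurable_frac_maximal frac_maximal_ge0 a0 c0 r1
  (torus_measure_fin n sin_neq0) level.
set B := ((_ * _ * _)%R); move=> H.
have r2 : 1 <= 2 `^ (r - 1) :> R.
  by rewrite -[leLHS](powRr0 2) ler_powR ?ler1n// subr_ge0 ltW.
have B0 : 0 <= B.
  by rewrite !mulr_ge0 ?powR_ge0// invr_ge0 subr_ge0.
have I0 : (0 <= \int[mu]_x (w x `^ r)%:E)%E.
  by apply: integral_ge0 => y _; rewrite lee_fin powR_ge0.
rewrite -poweR_EFin -poweRM ?lee_fin//.
apply: gt0_ler_poweR => //; rewrite ?in_itv /= ?leey ?andbT.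
- by apply: integral_ge0 => y _; exact: poweR_ge0.
- by rewrite mule_ge0// lee_fin.
Qed.

End one_function.

End maximal_bounds.

Theorem theorem5p2 (R : realType) (n : nat) (alpha : R)
    (n_gt0 : (0 < n)%N)
    (alphaNpi : forall k : int, alpha <> k%:~R * pi) :
  [/\ (exists C : R, forall f : RT R n -> R[i], chirp_Lp alpha 1%E f ->
         torus_weakL1 alpha (frac_maximal alpha f) /\
         (torus_weakL1norm alpha (frac_maximal alpha f)
            <= C%:E * torus_Lnorm alpha 1 (cabs f))%E),
      (forall p : \bar R, (1 < p)%E ->
         exists C : R, forall f : RT R n -> R[i], chirp_Lp alpha p f ->
           torus_Lp alpha p (frac_maximal alpha f) /\
           (torus_Lnorm alpha p (frac_maximal alpha f)
              <= C%:E * torus_Lnorm alpha p (cabs f))%E) &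
      (forall f : RT R n -> R[i], chirp_Lp alpha 1%E f ->
         {ae torus_measure alpha n, forall x,
           (fun N => frac_conv alpha f (fejer n N) x : R[i]^o) @ \oo
             --> (f x : R[i]^o)})].
Proof.
have sin0 := sin_neq0_of_not_int_mul_pi alphaNpi.
have finC (C : R) (p : \bar R) (f g : RT R n -> R[i]) (X : \bar R) : (1 <= p)%E ->
    torus_cLp alpha p g -> f = (fun x => chirpN alpha x * g x) %[ae torus_measure alpha n] ->
    (X <= C%:E * torus_Lnorm alpha p (cabs f))%E -> (X < +oo)%E.
  move=> p1 [_ _ gfin] fg /le_lt_trans; apply.
  rewrite (ae_eq_torus_Lnorm p1 (ae_eq_cabs fg)).
  have : torus_Lnorm alpha p (cabs g) \is a fin_num by rewrite ge0_fin_numE ?Lnorm_ge0.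
  by rewrite /cabs => /fineK <-; rewrite -EFinM ltry.
split.
- exists (2 * 864 ^+ n * 6 ^+ n) => f [g Lg fg]; have [_ mg _] := Lg.
  have le := weak_type_frac_maximal sin0 mg fg; split; last exact: le; split.
  + exact: frac_maximal_periodic fg.
  + exact: measurable_frac_maximal mg fg.
  + exact: (finC _ _ _ _ _ (lexx _) Lg fg le).
- case=> [r| |//] r1.
  + eexists => f [g Lg fg]; have [_ mg _] := Lg.
    have le := Lnorm_p_frac_maximal sin0 mg fg r1; split; last exact: le; split.
    * exact: frac_maximal_periodic fg.
    * exact: measurable_frac_maximal mg fg.
    * exact: (finC _ _ _ _ _ (ltW r1) Lg fg le).
  + exists (2 * 864 ^+ n) => f [g Lg fg]; have [_ mg gfin] := Lg.
    have le : (torus_Lnorm alpha +oo (frac_maximal alpha f) <=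
        (2 * 864 ^+ n)%:E * torus_Lnorm alpha +oo (cabs f))%E.
      apply: (Lnorm_oo_frac_maximal sin0 mg fg).
      by rewrite (ae_eq_torus_Lnorm (leey _) (ae_eq_cabs fg)).
    split; last exact: le; split.
    * exact: frac_maximal_periodic fg.
    * exact: measurable_frac_maximal mg fg.
    * exact: (finC _ _ _ _ _ (leey _) Lg fg le).
- move=> f [g [_ mg gfin] fg].
  have intg (u : RT R n -> R) : measurable_fun setT u -> (forall y, `|u y| <= Normc.normc (g y)) ->
      (torus_measure alpha n).-integrable setT (EFin \o u).
    move=> meas_u ug; apply/integrableP; split; first exact/measurable_EFinP.
    apply: le_lt_trans gfin; rewrite /torus_Lnorm Lnorm1; apply: ge0_le_integral => //.
    + by apply/measurable_EFinP; exact: measurableT_comp.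
    + apply: measurableT_comp => //; apply/measurable_EFinP.
      case: mg => mr mi; have := measurable_normc mr mi; apply: eq_measurable_fun => y _.
      by case: (g y).
    + by move=> y _; rewrite /cabs /= lee_fin [leRHS]ger0_norm ?normc_ge0.
  have [mr mi] := mg.
  have fE N x := frac_conv_fejerE fg N x.
  have [_ cr] := fejer_convergent_integrable sin0 (intg _ mr (fun y => Re_le_normc (g y))).
  have [_ ci] := fejer_convergent_integrable sin0 (intg _ mi (fun y => Im_le_normc (g y))).
  apply: filterS3 cr ci (fg) => x cr ci fgx.
  under eq_fun do rewrite fE.
  rewrite fgx//.
  have := cvg_complex (normc_cexpi (- (pi * sqnorm x * cot alpha))) cr ci.
  by case: (g x).
Qed.
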